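(* Assume that the set $\Omega_1=\Omega\setminus\{x\in\mathbb{R}_+^d:\ \exists\, i\in\{1,\dots,d\}\text{ such that }\sqrt{x_i}<1\}$ is open. If $f\in\mathcal{BV}_{\mathcal{L}^\alpha}(\Omega_1)$, then $$|\nabla_{\mathcal{L}^\alpha}f|(\Omega_1)\approx\int_{-\infty}^{+\infty}P_{\mathcal{L}^\alpha}(E_t,\Omega_1)\,dt,$$ where $E_t=\{x\in\Omega_1: f(x)>t\}$ for $t\in\mathbb{R}$. That is, there is a constant $c>0$, independent of $f$, such that $$c^{-1}\int_{-\infty}^{+\infty}P_{\mathcal{L}^\alpha}(E_t,\Omega_1)\,dt\le|\nabla_{\mathcal{L}^\alpha}f|(\Omega_1)\le c\int_{-\infty}^{+\infty}P_{\mathcal{L}^\alpha}(E_t,\Omega_1)\,dt.$$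
   Context: Let $\alpha=(\alpha_1,\dots,\alpha_d)\in(-1,\infty)^d$, $\mathbb{R}_+^d=(0,\infty)^d$, and let $\Omega\subset\mathbb{R}_+^d$ be an open set. The measure $\mu_\alpha$ on $\mathbb{R}_+^d$ is $d\mu_\alpha(x)=\omega(x)\,dx$ with $\omega(x)=\prod_{i=1}^d \frac{x_i^{\alpha_i}e^{-x_i}}{\Gamma(\alpha_i+1)}$. Put $\delta_i^*=-\sqrt{x_i}\Big(\frac{\partial}{\partial x_i}+\frac{\alpha_i+\frac12-x_i}{x_i}\Big)$ and $\mathrm{div}_{\mathcal{L}^\alpha}\varphi=\sum_{i=1}^d\delta_i^*\varphi_i$ for $C^1$ vector fields $\varphi=(\varphi_1,\dots,\varphi_d)$. For an open set $U\subset\mathbb{R}_+^d$, let $\mathcal{F}(U)$ be the set of all $\varphi\in C_c^1(U,\mathbb{R}^d)$ with $\sup_{x\in U}(|\varphi_1(x)|^2+\dots+|\varphi_d(x)|^2)^{1/2}\le 1$. The Laguerre variation of $f\in L^1(U,d\mu_\alpha)$ is $|\nabla_{\mathcal{L}^\alpha}f|(U)=\sup_{\varphi\in\mathcal{F}(U)}\int_U f\,\mathrm{div}_{\mathcal{L}^\alpha}\varphi\,d\mu_\alpha$, and $\mathcal{BV}_{\mathcal{L}^\alpha}(U)$ is the set of $f\in L^1(U,d\mu_\alpha)$ with $|\nabla_{\mathcal{L}^\alpha}f|(U)<\infty$. The $\mathcal{L}^\alpha$-perimeter of a (measurable) set $E\subset U$ is $P_{\mathcal{L}^\alpha}(E,U)=|\nabla_{\mathcal{L}^\alpha}1_E|(U)$.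 Constants may depend on $d$ and other fixed parameters. *)

(* Defs.v *)
From HB Require Import structures.
From mathcomp Require Export all_boot all_order all_algebra.
From mathcomp Require Export all_classical all_reals all_analysis.
From mathcomp Require Export measurable_realfun.
Export numFieldNormedType.Exports.

Set Implicit Arguments.
Unset Strict Implicit.
Unset Printing Implicit Defensive.
Import Order.TTheory GRing.Theory Num.Theory.
Local Open Scope classical_set_scope.
Local Open Scope ring_scope.

Definition measure_rV_display : measure_display.
Proof. exact. Qed.

(* As the library does for [n.-tuple T]: the sigma-algebra generated by the
   coordinate maps, i.e. the n-fold product of the Borel sigma-algebra of R. *)
Section measurable_rV.
Context {R : realType} (n : nat).

Definition rV_coord (i : 'I_n) (v : 'rV[R]_n) : measurableTypeR R := v ord0 i.

Let rV_set0 : g_sigma_preimage rV_coord set0.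
Proof. exact: sigma_algebra0. Qed.

Let rV_setC A : g_sigma_preimage rV_coord A -> g_sigma_preimage rV_coord (~` A).
Proof. exact: sigma_algebraC. Qed.

Let rV_bigcup (F : (set 'rV[R]_n)^nat) :
  (forall i, g_sigma_preimage rV_coord (F i)) ->
  g_sigma_preimage rV_coord (\bigcup_i (F i)).
Proof. exact: sigma_algebra_bigcup. Qed.

HB.instance Definition _ := @isMeasurable.Build measure_rV_display
  'rV[R]_n (g_sigma_preimage rV_coord) rV_set0 rV_setC rV_bigcup.

Lemma measurable_rV_coord (i : 'I_n) :
  measurable_fun [set: 'rV[R]_n] (rV_coord i).
Proof.
move=> _ Y mY; rewrite setTI; apply: sub_sigma_algebra => /=.
rewrite -bigcup_seq/=; exists i => /=; first by rewrite mem_index_enum.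
by exists Y => //; rewrite setTI.
Qed.

Lemma measurable_fun_rVP d (T : measurableType d) (f : T -> 'rV[R]_n) :
  (forall i, measurable_fun [set: T] (rV_coord i \o f)) ->
  measurable_fun [set: T] f.
Proof.
move=> mf; apply: (@measurability _ _ _ _ _ _
  (\big[setU/set0]_(i < n) preimage_set_system setT (rV_coord i) measurable)).
  by [].
move=> _ [A + <-]; rewrite -bigcup_seq => -[i _ [B mB <-]].
by have := mf i measurableT B mB; rewrite !setTI.
Qed.

End measurable_rV.

Section lebesgue_rV.
Context {R : realType}.
Local Open Scope ereal_scope.

Definition rV_cons n (p : measurableTypeR R * 'rV[R]_n) : 'rV[R]_n.+1 :=
  row_mx (p.1)%:M p.2 : 'rV[R]_(1 + n).

Definition rV_behead n (v : 'rV[R]_n.+1) : 'rV[R]_n := \row_i v ord0 (lift ord0 i).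

Lemma rV_cons0 n p : @rV_cons n p ord0 ord0 = p.1.
Proof.
have -> : ord0 = lshift n (ord0 : 'I_1) :> 'I_(1 + n) by exact/val_inj.
by rewrite [LHS]row_mxEl mxE eqxx mulr1n.
Qed.

Lemma rV_consS n p i : @rV_cons n p ord0 (lift ord0 i) = p.2 ord0 i.
Proof.
have -> : lift ord0 i = rshift 1 i :> 'I_(1 + n) by exact/val_inj.
by rewrite [LHS]row_mxEr.
Qed.

Lemma rV_behead_cons n p : rV_behead (@rV_cons n p) = p.2.
Proof. by apply/rowP => i; rewrite mxE rV_consS. Qed.

Lemma measurable_rV_cons n : measurable_fun setT (@rV_cons n).
Proof.
apply: measurable_fun_rVP => i.
case: (unliftP ord0 i) => [j ->|->].
  rewrite (_ : _ \o _ = rV_coord j \o snd).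
    by apply: measurableT_comp => //; exact: measurable_rV_coord.
  by apply/funext => p /=; rewrite /rV_coord rV_consS.
rewrite (_ : _ \o _ = fst) //.
by apply/funext => p /=; rewrite /rV_coord rV_cons0.
Qed.

Lemma measurable_rV_behead n : measurable_fun setT (@rV_behead n).
Proof.
apply: measurable_fun_rVP => i.
rewrite (_ : _ \o _ = rV_coord (lift ord0 i)); first exact: measurable_rV_coord.
by apply/funext => v; rewrite /= /rV_coord mxE.
Qed.

Section step.
Context (n : nat).
Variable m : {sigma_finite_measure set 'rV[R]_n -> \bar R}.

Definition lebesgue_rV_step : set 'rV[R]_n.+1 -> \bar R :=
  pushforward (@lebesgue_measure R \x m) (@rV_cons n).

Let step0 : lebesgue_rV_step set0 = 0.
Proof. by rewrite /lebesgue_rV_step /pushforward preimage_set0 measure0. Qed.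

Let step_ge0 A : 0 <= lebesgue_rV_step A.
Proof. by rewrite /lebesgue_rV_step /pushforward measure_ge0. Qed.

Let mpre (A : set 'rV[R]_n.+1) : measurable A -> measurable (@rV_cons n @^-1` A).
Proof. by move=> mA; rewrite -[X in measurable X]setTI; exact: measurable_rV_cons. Qed.

Let step_sigma_additive : semi_sigma_additive lebesgue_rV_step.
Proof.
move=> F mF tF mUF; rewrite /lebesgue_rV_step /pushforward preimage_bigcup.
apply: measure_semi_sigma_additive.
- by move=> k; exact: mpre.
- apply/trivIsetP => /= i j _ _ ij; rewrite -preimage_setI.
  by move/trivIsetP : tF => /(_ _ _ _ _ ij) ->//; rewrite preimage_set0.
- by rewrite -preimage_bigcup; exact: mpre.
Qed.

HB.instance Definition _ := isMeasure.Build _ _ _ lebesgue_rV_step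
  step0 step_ge0 step_sigma_additive.

Let step_sigma_finite : sigma_finite setT lebesgue_rV_step.
Proof.
have /sigma_finiteP[F [FT Fnd Foo]] := sigma_finiteT (@lebesgue_measure R).
have /sigma_finiteP[G [GT Gnd Goo]] := sigma_finiteT m.
pose H k := (rV_coord ord0 @^-1` F k) `&` (@rV_behead n @^-1` G k).
exists H.
  apply/seteqP; split => // v _.
  have [i _ Fi] : (\bigcup_i F i) (rV_coord ord0 v) by rewrite -FT.
  have [j _ Gj] : (\bigcup_i G i) (rV_behead v) by rewrite -GT.
  exists (maxn i j) => //; split.
    by have /subsetPset := Fnd _ _ (leq_maxl i j); exact.
  by have /subsetPset := Gnd _ _ (leq_maxr i j); exact.
move=> k; have [mF Fk] := Foo k; have [mG Gk] := Goo k; split.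
  apply: measurableI; rewrite -[X in measurable X]setTI.
    exact: measurable_rV_coord.
  exact: measurable_rV_behead.
rewrite /lebesgue_rV_step /pushforward (_ : _ @^-1` _ = F k `*` G k).
  by rewrite product_measure1E// lte_mul_pinfty// ge0_fin_numE.
apply/seteqP; split => -[x v]; rewrite /H /= rV_behead_cons.
  by rewrite /rV_coord rV_cons0.
by rewrite /rV_coord rV_cons0.
Qed.

HB.instance Definition _ := Measure_isSigmaFinite.Build _ _ _ lebesgue_rV_step
  step_sigma_finite.

End step.

(* Lebesgue measure on R^n: unit mass at the only point for n = 0, and the
   product of the measures on R and R^n for n.+1. *)
Fixpoint lebesgue_rV (n : nat) : {sigma_finite_measure set 'rV[R]_n -> \bar R} :=
  if n is k.+1 then lebesgue_rV_step (lebesgue_rV k)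
  else \d_(0%R : 'rV[R]_0).

End lebesgue_rV.

Section laguerre.
Context {R : realType}.

Definition Gamma (s : R) : R :=
  \int[@lebesgue_measure R]_(t in `]0, +oo[) (t `^ (s - 1) * expR (- t)).

Context {d : nat}.
Implicit Types (alpha x : 'rV[R]_d) (U E : set 'rV[R]_d) (f g : 'rV[R]_d -> R).

Definition pos_orthant : set 'rV[R]_d := [set x | forall i, 0 < x 0 i].

Definition laguerre_density alpha x : R :=
  \prod_(i < d) (x 0 i `^ alpha 0 i * expR (- x 0 i) / Gamma (alpha 0 i + 1)).

Definition laguerre_measure alpha : set 'rV[R]_d -> \bar R :=
  fun A => (\int[lebesgue_rV d]_(x in A `&` pos_orthant)
              (laguerre_density alpha x)%:E)%E.

Lemma Gamma_ge0 s : 0 <= Gamma s.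
Proof.
by apply: Rintegral_ge0 => t _; rewrite mulr_ge0 ?powR_ge0 ?expR_ge0.
Qed.

Lemma laguerre_density_ge0 alpha x : 0 <= laguerre_density alpha x.
Proof.
apply: prodr_ge0 => i _.
by rewrite !mulr_ge0 ?powR_ge0 ?expR_ge0 ?invr_ge0 ?Gamma_ge0.
Qed.

Lemma measurable_laguerre_density alpha :
  measurable_fun [set: 'rV[R]_d] (laguerre_density alpha).
Proof.
apply: measurable_prod => i _.
have mi : measurable_fun [set: 'rV[R]_d] (fun x : 'rV[R]_d => x 0 i).
  exact: measurable_rV_coord.
apply: measurable_funM => //; apply: measurable_funM => //.
  by apply: (measurableT_comp (f := fun t : R => t `^ alpha 0 i)).
by do 2 apply: measurableT_comp => //.
Qed.

Lemma measurable_pos_orthant : measurable pos_orthant.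
Proof.
rewrite (_ : pos_orthant = \bigcap_(i in [set: 'I_d])
    (rV_coord i @^-1` `]0, +oo[)).
  apply: fin_bigcap_measurable => // i _; rewrite -[X in measurable X]setTI.
  exact: measurable_rV_coord.
apply/seteqP; split => x /= xP i.
  by move=> _; rewrite /= /rV_coord in_itv/= andbT; exact: xP.
by have := xP i I; rewrite /= /rV_coord in_itv/= andbT.
Qed.

Section instances.
Variable alpha : 'rV[R]_d.

Let mu0 : laguerre_measure alpha set0 = 0%E.
Proof. by rewrite /laguerre_measure set0I integral_set0. Qed.

Let mu_ge0 A : (0 <= laguerre_measure alpha A)%E.
Proof. by apply: integral_ge0 => x _; rewrite lee_fin laguerre_density_ge0. Qed.

Let mu_sigma_additive : semi_sigma_additive (laguerre_measure alpha).
Proof.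
move=> F mF tF mUF; rewrite /laguerre_measure setI_bigcupl.
rewrite ge0_integral_bigcup//=.
- apply: is_cvg_ereal_nneg_natsum_cond => n _ _.
  by apply: integral_ge0 => x _; rewrite lee_fin laguerre_density_ge0.
- by move=> k; apply: measurableI => //; exact: measurable_pos_orthant.
- apply/measurable_EFinP/measurable_funTS; exact: measurable_laguerre_density.
- by move=> x _; rewrite lee_fin laguerre_density_ge0.
- by apply: trivIset_setIr.
Qed.

HB.instance Definition _ := isMeasure.Build _ _ _ (laguerre_measure alpha)
  mu0 mu_ge0 mu_sigma_additive.

End instances.

Definition partial (i : 'I_d) g x : R := 'D_(delta_mx 0 i : 'rV[R]_d) g x.

Definition delta_star alpha (i : 'I_d) g x : R :=
  - Num.sqrt (x 0 i) *
    (partial i g x + (alpha 0 i + 2^-1 - x 0 i) / x 0 i * g x).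

Definition div_laguerre alpha (phi : 'rV[R]_d -> 'rV[R]_d) x : R :=
  \sum_(i < d) delta_star alpha i (fun y => phi y 0 i) x.

(* Functions on U are represented by functions on the whole space whose values
   outside of U are irrelevant; U is meant to be open. *)
Definition C1_on U g : Prop := forall (i : 'I_d) x, U x ->
  derivable g x (delta_mx 0 i : 'rV[R]_d) /\ {for x, continuous (partial i g)}.

Definition compactly_supported_in U (phi : 'rV[R]_d -> 'rV[R]_d) : Prop :=
  let S := closure [set x | U x /\ phi x != 0] in compact S /\ S `<=` U.

Definition test_fields U : set ('rV[R]_d -> 'rV[R]_d) :=
  [set phi : 'rV[R]_d -> 'rV[R]_d | [/\ forall j, C1_on U (fun x => phi x 0 j),
                 compactly_supported_in U phi &
                 forall x, U x ->
                   Num.sqrt (\sum_(j < d) `|phi x 0 j| ^+ 2) <= 1]].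

Definition laguerre_variation alpha U f : \bar R :=
  ereal_sup [set (\int[laguerre_measure alpha]_(x in U)
                    (f x * div_laguerre alpha phi x)%:E)%E
            | phi in test_fields U].

Definition laguerre_BV alpha U f : Prop :=
  (laguerre_measure alpha).-integrable U (EFin \o f) /\
  (laguerre_variation alpha U f < +oo)%E.

Definition laguerre_perimeter alpha E U : \bar R :=
  laguerre_variation alpha U \1_E.

End laguerre.

(* Main.v *)
(** The density [w] of [mu_alpha] turns [div_laguerre] into a divergence:
    [w * div phi = - sum_i d_i (W_i * phi_i)] with [W_i = sqrt(x_i) * w], so the
    Laguerre variation is a weighted total variation for Lebesgue measure.

    Upper bound: since [f = int (1_{t<f} - 1_{t<0}) dt] and [w * div phi] has
    integral zero, Fubini gives [int f div phi = int_t int 1_{E_t} div phi],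
    which is at most the integral of the perimeters.

    Lower bound: no approximation by smooth functions is needed, because constants
    are allowed.  Moving difference quotients from the test field to the function,
    the perimeter of [E_t] is at most a constant times the sum over [i] of the
    liminf of the weighted [L^1] norms of
    [(1_{E_t}(x + h e_i) - 1_{E_t}(x)) / h].  These norms integrate over [t]
    exactly to those of [(f(x + h e_i) - f(x)) / h], so by Fatou it remains to
    bound the latter by the variation of [f].  Replacing the sign of
    [f(x + h e_i) - f(x)] by a smooth [F], the primitive
    [phi_i(y) = (1 / w_i(y_i)) int_0^h (w_i F)(y - s e_i) ds] of the one-variable
    weight [w_i] times [F] is a test field of size [O(h)]: on [x_i >= 1] the
    weights [w_i] at two points of distance at most one are comparable. *)
Require Import Defs.
From mathcomp Require Import ring lra.
Set Implicit Arguments.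
Unset Strict Implicit.
Unset Printing Implicit Defensive.
Import Order.TTheory GRing.Theory Num.Theory.
Local Open Scope classical_set_scope.
Local Open Scope ring_scope.

(** * Lebesgue measure on row vectors *)

(** The test field must be continuously differentiable in every coordinate, although it is a
    primitive along one of them. This is why [F] is taken to be a [tensor], a finite sum of products
    of one-variable functions: a primitive along [e_i] then changes one factor per term, and the
    one-variable fundamental theorem replaces differentiation under the integral sign. Tensors are
    still rich enough: the measurable sets whose indicators they approximate in a given weighted
    [L^1] norm form a sigma-algebra that contains the half-spaces. Translations may leave the open
    set, so [F] carries a cutoff, itself a tensor, built from finitely many rational cubes; the step
    [h] is chosen after the cutoff and does not exceed the radii of these cubes. Cutoff and step
    depend on [n] and the open set only, never on [t], [f] or the test field, so the liminf over [n]
    can be taken under the integral in [t]. The constant is [1 + sum_i 4^d * exp(1 + |alpha_i + 1/2|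
    * ln 2)]: [4^d] is the price of replacing a test field by the cutoffs, and the exponential
    compares weights at distance at most one. *)

Section nonmeasurable_comparison.
Local Open Scope ereal_scope.
Context d (T : measurableType d) (R : realType).
Variable mu : {measure set T -> \bar R}.

(* [g] need not be measurable: the integral of a nonnegative function is a
   supremum over simple minorants. *)
Lemma le_integral_ge0r (f g : T -> \bar R) :
  (forall x, 0 <= g x) -> (forall x, f x <= g x) ->
  \int[mu]_x f x <= \int[mu]_x g x.
Proof.
move=> g0 fg; apply: (@le_trans _ _ (\int[mu]_x f^\+ x)).
  rewrite integralE.
  apply: geeDl; rewrite oppe_le0; exact: integral_ge0.
rewrite !ge0_integralTE//; apply: ge_ereal_sup => _ [h hf <-].
apply: ereal_sup_ubound; exists h => // x.
by rewrite (le_trans (hf x))// funeposE ge_max fg g0.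
Qed.
End nonmeasurable_comparison.

Section euclidean_measure.
Context {R : realType}.
Local Notation lambda := (@lebesgue_measure R).

Lemma measurable_shiftR (c : R) : measurable_fun setT
  (fun x : measurableTypeR R => x + c : measurableTypeR R).
Proof. exact: measurable_funD. Qed.

Lemma lebesgue_measure_shift (c : R) (A : set R) : measurable A ->
  lambda ((fun x : R => x + c) @^-1` A) = lambda A.
Proof.
move=> mA; apply/esym.
have mf := measurable_shiftR c.
apply: (@lebesgue_measure_unique R (pushforward lambda
  (fun x : measurableTypeR R => x + c : measurableTypeR R))) => // _ [[a b]] _ <-.
change (lambda `]a, b] = lambda ((fun x : R => x + c) @^-1` `]a, b]%classic)).
rewrite (_ : (_ @^-1` _) = `]a - c, b - c]%classic :> set R); last first.
  by apply/seteqP; split => x /=; rewrite !in_itv/= ltrBlDr lerBrDr.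
rewrite !lebesgue_measure_itv/= !lte_fin ltrD2r; case: ifPn => // _.
by rewrite -!EFinD; congr EFin; ring.
Qed.

Lemma measurable_shift_rV n (u : 'rV[R]_n) :
  measurable_fun setT (fun x : 'rV[R]_n => x + u).
Proof.
apply: measurable_fun_rVP => i.
rewrite (_ : _ \o _ = (fun x => rV_coord i x + u ord0 i)); last first.
  by apply/funext => x; rewrite /= /rV_coord mxE.
by apply: measurable_funD => //; exact: measurable_rV_coord.
Qed.

(** Induction on [n]: through [rV_cons] a translation acts on head and tail separately, and a
    product of sigma-finite measures is determined by its values on rectangles. *)
Lemma lebesgue_rV_shift n (u : 'rV[R]_n) (A : set 'rV[R]_n) : measurable A ->
  lebesgue_rV n ((fun x => x + u) @^-1` A) = lebesgue_rV n A.
Proof.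
elim: n u A => [|n IHn] u A mA.
  rewrite (_ : _ @^-1` A = A)//; apply/seteqP; split => x /=;
  by rewrite (_ : x + u = x)//; apply/rowP => -[].
rewrite /= /lebesgue_rV_step /pushforward.
pose v := rV_behead u.
pose tau (p : measurableTypeR R * 'rV[R]_n) : measurableTypeR R * 'rV[R]_n :=
  (p.1 + u ord0 ord0, p.2 + v).
have mtau : measurable_fun setT tau.
  apply/measurable_fun_pairP; split => /=.
    by apply: measurable_funD => //.
  by apply: (measurableT_comp (measurable_shift_rV v)).
have consE p : rV_cons p + u = rV_cons (tau p).
  apply/rowP => i; rewrite mxE; case: (unliftP ord0 i) => [j ->|->].
    by rewrite !rV_consS /= !mxE.
  by rewrite !rV_cons0.
have mc : measurable (@rV_cons R n @^-1` A).
  by rewrite -[X in measurable X]setTI; exact: measurable_rV_cons.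
transitivity (pushforward (lambda \x lebesgue_rV n)%E tau (@rV_cons R n @^-1` A)).
  rewrite /pushforward; congr (_ _).
  by apply/seteqP; split => p /=; rewrite consE.
apply/esym.
apply: (@product_measure_unique _ _ _ _ _ lambda (lebesgue_rV n)
  (pushforward (lambda \x lebesgue_rV n)%E tau)) => // B C mB mC.
transitivity ((lambda \x lebesgue_rV n)%E
  (((fun x => x + u ord0 ord0) @^-1` B) `*` ((fun x => x + v) @^-1` C))) => //.
have mB' : measurable ((fun x : measurableTypeR R => x + u ord0 ord0) @^-1` B).
  rewrite -[X in measurable X]setTI.
  exact: measurable_shiftR.
rewrite product_measure1E//.
  by rewrite IHn// [X in (X * _)%E]lebesgue_measure_shift.
by rewrite -[X in measurable X]setTI; exact: measurable_shift_rV.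
Qed.

Lemma ge0_integral_rV_shift n (u : 'rV[R]_n) (f : 'rV[R]_n -> \bar R) :
  measurable_fun setT f -> (forall x, 0 <= f x)%E ->
  (\int[lebesgue_rV n]_x f (x + u)%R = \int[lebesgue_rV n]_x f x)%E.
Proof.
move=> mf f0; have mu := measurable_shift_rV u.
transitivity (\int[pushforward (lebesgue_rV n) (fun x => (x + u)%R)]_x f x)%E.
  by rewrite ge0_integral_pushforward//= preimage_setT.
by apply: eq_measure_integral => A mA _; exact: lebesgue_rV_shift.
Qed.

Lemma integral_rV_shift n (u : 'rV[R]_n) (f : 'rV[R]_n -> \bar R) :
  measurable_fun setT f ->
  (\int[lebesgue_rV n]_x f (x + u)%R = \int[lebesgue_rV n]_x f x)%E.
Proof.
move=> mf; rewrite integralE [in RHS]integralE; congr (_ - _)%E.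
  rewrite -(@ge0_integral_rV_shift n u (f^\+)%E)//; last exact: measurable_funepos.
  by apply: eq_integral => x _; rewrite !funeposE.
rewrite -(@ge0_integral_rV_shift n u (f^\-)%E)//; last exact: measurable_funeneg.
by apply: eq_integral => x _; rewrite !funenegE.
Qed.

Lemma integrable_rV_shift n (u : 'rV[R]_n) (f : 'rV[R]_n -> \bar R) :
  (lebesgue_rV n).-integrable setT f ->
  (lebesgue_rV n).-integrable setT (fun x => f (x + u)).
Proof.
move=> /integrableP[mf foo]; apply/integrableP; split.
  by apply: (measurableT_comp mf); exact: measurable_shift_rV.
rewrite (@ge0_integral_rV_shift n u (fun x => `|f x|%E))//.
exact: measurableT_comp.
Qed.

Definition cube n (r : R) : set 'rV[R]_n := [set x | forall i, `|x ord0 i| <= r].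
Arguments cube : clear implicits.

Lemma measurable_cube n r : measurable (cube n r).
Proof.
rewrite (_ : cube n r = \bigcap_(i in [set: 'I_n]) (rV_coord i @^-1` `[- r, r])).
  apply: fin_bigcap_measurable => // i _; rewrite -[X in measurable X]setTI.
  exact: measurable_rV_coord.
apply/seteqP; split => x /= xP i.
  by move=> _; rewrite /= /rV_coord in_itv/= -ler_norml.
by have := xP i I; rewrite /= /rV_coord in_itv/= -ler_norml.
Qed.

Lemma lebesgue_rV_cube n r : (lebesgue_rV n (cube n r) < +oo)%E.
Proof.
elim: n => [|n IHn] /=.
  rewrite diracE; case: (_ \in _) => //=; exact: ltry.
rewrite /lebesgue_rV_step /pushforward.
rewrite (_ : @rV_cons R n @^-1` cube n.+1 r = `[- r, r] `*` cube n r).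
  rewrite product_measure1E//; last exact: measurable_cube.
  rewrite lte_mul_pinfty//.
  rewrite [X in X \is a fin_num]lebesgue_measure_itv/=; case: ifP => _ //=.
apply/seteqP; split => -[x v] /=.
  move=> H; split; first by have := H ord0; rewrite rV_cons0/= in_itv/= -ler_norml.
  by move=> i; have := H (lift ord0 i); rewrite rV_consS.
move=> [H1 H2] i; case: (unliftP ord0 i) => [j ->|->].
  by rewrite rV_consS; exact: H2.
by rewrite rV_cons0/= ler_norml; move: H1; rewrite in_itv.
Qed.

End euclidean_measure.
Arguments cube {R} n r.

(** * Rational cubes and continuously differentiable functions *)

Section topology.
Context {R : realType} {d : nat}.
Implicit Types (U : set 'rV[R]_d) (x y : 'rV[R]_d).

Lemma nbhs_rVP x (A : set 'rV[R]_d) : nbhs x A <->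
  exists2 e : R, 0 < e & forall y, (forall j, `|y 0 j - x 0 j| < e) -> A y.
Proof.
split=> [/nbhs_ballP[e /= e0 xA]|[e e0 xA]].
  exists e => // y xy; apply: xA; split => // i j.
  by rewrite ord1 /ball/= distrC; exact: xy.
apply/nbhs_ballP; exists e => //= y [_ xy]; apply: xA => j.
by have := xy 0 j; rewrite /ball/= distrC.
Qed.

(** Enumerates all rational centres and radii by their pickle codes. An index that codes nothing
    yields radius 0 and is discarded by [good_cube]. *)
Definition rational_cube (q : nat) : 'rV[R]_d * R :=
  let p := odflt (0, 0) (unpickle q : option ('rV[rat]_d * rat)) in
  (map_mx ratr p.1, ratr p.2).

Local Notation ctr q := (rational_cube q).1.
Local Notation rad q := (rational_cube q).2.

(** Three concentric sizes are in play: a bump is bounded below on the half cube, supported in the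
    cube of radius [rad q], and its translates by at most [rad q] stay in the double cube. *)
Definition inner_cube q : set 'rV[R]_d :=
  [set x | forall j, `|x 0 j - ctr q 0 j| < rad q / 2].

Definition outer_cube q : set 'rV[R]_d :=
  [set x | forall j, `|x 0 j - ctr q 0 j| <= rad q * 2].

Definition good_cube U q : Prop := 0 < rad q /\ outer_cube q `<=` U.

Lemma good_cube_cover U x : open U -> U x -> exists2 q, good_cube U q & inner_cube q x.
Proof.
move=> oU Ux; have /nbhs_rVP[e e0 xU] : nbhs x U by apply: open_nbhs_nbhs.
(* With [r < e / 3], points of the outer cube lie within [2 * r + r / 2 < e] of [x]. *)
have [r] : exists r : rat, ratr r \in `]0, e / 3[%R by apply: rat_in_itvoo; lra.
rewrite in_itv/= => /andP[r0 re].
have /choice[c hc] : forall j, exists c : rat, `|x 0 j - ratr c| < (ratr r : R) / 2.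
  move=> j; have [c] : exists c : rat,
      ratr c \in `](x 0 j - ratr r / 2), (x 0 j + ratr r / 2)[%R.
    by apply: rat_in_itvoo; lra.
  rewrite in_itv/= => /andP[c1 c2]; exists c; rewrite ltr_norml; lra.
have E : rational_cube (pickle (\row_j c j, r)) = (map_mx ratr (\row_j c j), ratr r).
  by rewrite /rational_cube pickleK.
exists (pickle (\row_j c j, r)).
  split; first by rewrite E.
  move=> y; rewrite /outer_cube /mkset E => yc.
  apply: xU => j; have := yc j; have := hc j; rewrite !mxE /= => h1 h2.
  rewrite (_ : _ - _ = (y 0 j - ratr (c j)) - (x 0 j - ratr (c j))); last by ring.
  apply: le_lt_trans (ler_normB _ _) _; lra.
by rewrite /inner_cube /mkset E => j; rewrite !mxE; exact: hc.
Qed.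

Lemma measurable_inner_cube q : measurable (inner_cube q).
Proof.
rewrite (_ : inner_cube q = \bigcap_(i in [set: 'I_d]) (rV_coord i @^-1`
    `](ctr q 0 i - rad q / 2), (ctr q 0 i + rad q / 2)[)).
  apply: fin_bigcap_measurable => // i _; rewrite -[X in measurable X]setTI.
  exact: measurable_rV_coord.
apply/seteqP; split => x /= xP i.
  move=> _; have := xP i; rewrite /= /rV_coord in_itv/= ltr_norml => /andP[]; lra.
have := xP i I; rewrite /= /rV_coord in_itv/= ltr_norml => /andP[]; lra.
Qed.

(** The sigma-algebra is generated by the coordinate maps, so open sets have to be written as
    countable unions of rational cubes. *)
Lemma open_measurable_rV U : open U -> measurable U.
Proof.
move=> oU; rewrite (_ : U = \bigcup_(q in [set q | good_cube U q]) inner_cube q).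
  by apply: bigcup_measurable => q _; exact: measurable_inner_cube.
apply/seteqP; split => [x Ux|x [q [r0 qU] qx]].
  by have [q gq qx] := good_cube_cover oU Ux; exists q.
by apply: qU => j; apply: le_trans (ltW (qx j)) _; lra.
Qed.

Lemma open_continuous_measurable_rV U (f : 'rV[R]_d -> R) : open U ->
  (forall x, U x -> {for x, continuous f}) -> measurable_fun U f.
Proof.
move=> oU cf; apply: (measurability _ (RGenOInfty.measurableE R)) => _ [_ [a ->] <-].
apply: open_measurable_rV; rewrite openE => x [Ux fx].
have nU : nbhs x U by apply: open_nbhs_nbhs.
have nf : nbhs x (f @^-1` `]a, +oo[).
  by apply: (cf x Ux); apply: open_nbhs_nbhs; split => //; exact: interval_open.
by near=> y; split; near: y.
Unshelve. all: by end_near. Qed.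

End topology.

Section calculus.
Context {R : realType}.

Lemma derivable_bound (f df : R -> R) (a b M : R) :
  (forall s, `|s - a| <= `|b - a| -> is_derive s (1 : R) f (df s)) ->
  (forall s, `|s - a| <= `|b - a| -> `|df s| <= M) ->
  `|f b - f a| <= M * `|b - a|.
Proof.
move=> fdf dfM.
have [ab|ba|->] := ltgtP a b; last by rewrite !subrr normr0 mulr0.
  have H s : s \in `[a, b] -> `|s - a| <= `|b - a|.
    by rewrite in_itv/= => /andP[as_ sb]; rewrite !ger0_norm; lra.
  have [||c cab ->] := @MVT_segment R f df a b (ltW ab).
  - by move=> x xab; apply/fdf/H; exact: subset_itv_oo_cc.
  - apply: derivable_within_continuous => x xab.
    by have /fdf[] := H _ xab.
  - by rewrite normrM ler_wpM2r// dfM// H.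
have H s : s \in `[b, a] -> `|s - a| <= `|b - a|.
  by rewrite in_itv/= => /andP[as_ sb]; rewrite !ler0_norm; lra.
rewrite distrC [X in _ * X]distrC.
have [||c cab ->] := @MVT_segment R f df b a (ltW ba).
- by move=> x xab; apply/fdf/H; exact: subset_itv_oo_cc.
- apply: derivable_within_continuous => x xab.
  by have /fdf[] := H _ xab.
- by rewrite normrM ler_wpM2r// dfM// H.
Qed.

(** Both difference quotients are the same function of the increment; directional derivatives
    thereby reduce to one-variable calculus. *)
Lemma is_derive_line (V : normedModType R) (g : V -> R) (x v : V) (t l : R) :
  is_derive (x + t *: v) v g l <-> is_derive t (1 : R) (fun s => g (x + s *: v)) l.
Proof.
pose G s := g (x + s *: v).
have E : (fun h : R => h^-1 *: ((g \o shift (x + t *: v)) (h *: v) - g (x + t *: v)))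
  = (fun h : R => h^-1 *: ((G \o shift t) (h *: (1 : R)) - G t)).
  apply/funext => h /=; rewrite /G /shift; congr (_ *: (g _ - _)).
  by rewrite [_ *: 1]mulr1 scalerDl addrCA.
have dE : 'D_v g (x + t *: v) = 'D_1 G t by rewrite /derive E.
have dP : derivable g (x + t *: v) v = derivable G t 1 by rewrite /derivable E.
split => -[dg dl].
  by apply: DeriveDef; [rewrite -dP|rewrite -dE].
by apply: DeriveDef; [rewrite dP|rewrite dE].
Qed.

End calculus.

Section C1.
Context {R : realType} {d : nat}.
Implicit Types (U : set 'rV[R]_d) (x y : 'rV[R]_d).

Lemma rV_segment_bound (g : 'rV[R]_d -> R) x v (t M : R) :
  (forall s, `|s| <= `|t| -> derivable g (x + s *: v) v) ->
  (forall s, `|s| <= `|t| -> `|'D_v g (x + s *: v)| <= M) ->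
  `|g (x + t *: v) - g x| <= M * `|t|.
Proof.
move=> dg gM.
have := @derivable_bound R (fun s => g (x + s *: v)) (fun s => 'D_v g (x + s *: v)) 0 t M.
rewrite !subr0 scale0r addr0; apply => s; rewrite !subr0 => st.
  by apply: (proj1 (is_derive_line g x v s _)); apply: derivableP; exact: dg.
exact: gM.
Qed.

(** [C1_on] speaks of partial derivatives only. Near [x] they are bounded by some [M]; the points
    [z y k], with the first [k] coordinates of [y] and the others of [x], lead from [x] to [y] by
    changing one coordinate at a time, each change costing at most [M * r]. *)
Lemma C1_continuous U (g : 'rV[R]_d -> R) x : open U -> C1_on U g -> U x ->
  {for x, continuous g}.
Proof.
move=> oU gC1 Ux.
have [M M0 nM] : exists2 M : R, 0 < M &
    nbhs x [set y | forall i, `|partial i g y| <= M].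
  have H i : nbhs x [set y | `|partial i g y| <= `|partial i g x| + 1].
    have [_ ci] := gC1 i x Ux.
    have /cvgrPdist_le /(_ 1 ltr01) := ci; apply: filterS => y /= hy.
    rewrite -lerBlDl; apply: le_trans hy; rewrite distrC; exact: lerB_dist.
  exists (\sum_i `|partial i g x| + 1).
    by rewrite ltr_wpDl// sumr_ge0.
  have := @filter_forall _ 'I_d _ (nbhs x) (nbhs_filter x) H.
  apply: filterS => y hy i; apply: le_trans (hy i) _.
  by rewrite lerD2r (bigD1 i)//= lerDl sumr_ge0.
have /nbhs_rVP[e e0 xe] : nbhs x ([set y | forall i, `|partial i g y| <= M] `&` U).
  by apply: filterI => //; exact: open_nbhs_nbhs.
pose z y k : 'rV[R]_d := \row_j (if (j < k)%N then y 0 j else x 0 j).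
have main y (r : R) : r < e -> (forall j, `|y 0 j - x 0 j| <= r) -> forall k, (k <= d)%N ->
    `|g (z y k) - g x| <= M * r * k%:R.
  move=> re yx; elim=> [_|k IHk kd].
    rewrite (_ : z y 0%N = x) ?subrr ?normr0 ?mulr0//.
    by apply/rowP => j; rewrite mxE.
  have r0 : 0 <= r by apply: le_trans (yx (Ordinal kd)).
  pose v : 'rV[R]_d := delta_mx 0 (Ordinal kd).
  have zE : z y k.+1 = z y k + (y 0 (Ordinal kd) - x 0 (Ordinal kd)) *: v.
    apply/rowP => j; rewrite !mxE eqxx/=.
    case: (eqVneq j (Ordinal kd)) => [->/=|jk].
      by rewrite ltnS leqnn ltnn mulr1 addrC subrK.
    rewrite mulr0 addr0 ltnS leq_eqVlt (_ : (j == k :> nat) = false)//.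
    by apply/negbTE; apply: contra jk => /eqP jk; apply/eqP/val_inj.
  have zin s : `|s| <= `|y 0 (Ordinal kd) - x 0 (Ordinal kd)| ->
      forall j, `|(z y k + s *: v) 0 j - x 0 j| < e.
    move=> hs j; apply: le_lt_trans re; rewrite !mxE eqxx/=.
    case: (eqVneq j (Ordinal kd)) => [->/=|jk].
      by rewrite ltnn mulr1 addrC addKr (le_trans hs).
    by rewrite mulr0 addr0; case: ifPn => _ //; rewrite subrr normr0.
  rewrite zE -(subrK (g (z y k)) (g (_ + _))) -addrA.
  apply: le_trans (ler_normD _ _) _; rewrite -natr1 mulrDr mulr1 [leRHS]addrC.
  apply: lerD; last by apply: IHk; exact: ltnW.
  apply: (@le_trans _ _ (M * `|y 0 (Ordinal kd) - x 0 (Ordinal kd)|)).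
    apply: rV_segment_bound => s hs.
      by have [_ Us] := xe _ (zin s hs); have [] := gC1 (Ordinal kd) _ Us.
    by have [hM _] := xe _ (zin s hs); exact: hM.
  by rewrite ler_wpM2l// ltW.
have FF : Filter (nbhs x) by exact: nbhs_filter.
rewrite /prop_for /continuous_at.
apply/(@cvgrPdist_lt _ _ _ (nbhs x) FF) => eps eps0; apply/nbhs_rVP.
pose r := Num.min (e / 2) (eps / (M * d%:R + 1)).
have D0 : 0 < M * d%:R + 1 by rewrite ltr_wpDl// mulr_ge0// ltW.
have r0 : 0 < r by rewrite lt_min divr_gt0//= divr_gt0.
exists r => // y yr /=.
have re : r < e by rewrite /r gt_min; apply/orP; left; lra.
have := main y r re (fun j => ltW (yr j)) d (leqnn d).
rewrite (_ : z y d = y); last by apply/rowP => j; rewrite mxE ltn_ord.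
rewrite distrC => /le_lt_trans; apply.
apply: (@lt_le_trans _ _ (r * (M * d%:R + 1))).
  by rewrite mulrDr mulr1 -mulrA mulrCA ltrDl.
by rewrite -ler_pdivlMr// /r ge_min lexx orbT.
Qed.

End C1.

(** * Layer-cake formulas *)

Section density.
Local Open Scope ereal_scope.
Context d (T : measurableType d) (R : realType).
Variables (nu mu : {measure set T -> \bar R}) (D : set T) (w : T -> R).
Hypotheses (mD : measurable D) (mw : measurable_fun D w).
Hypothesis w0 : forall x, (0 <= w x)%R.
Hypothesis nuE : forall A, measurable A -> A `<=` D ->
  nu A = \int[mu]_(x in A) (w x)%:E.
Import HBNNSimple.

(** Both sides are monotone limits along the same simple functions, and for a simple function [nuE]
    applies to each level set inside [D]. *)
Lemma ge0_integral_density (f : T -> R) : measurable_fun D f ->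
  (forall x, D x -> 0 <= f x)%R ->
  \int[nu]_(x in D) (f x)%:E = \int[mu]_(x in D) (f x * w x)%:E.
Proof.
move=> mf f0.
have mEf : measurable_fun D (EFin \o f) by exact/measurable_EFinP.
have f0' x : D x -> 0 <= (EFin \o f) x by move=> Dx; rewrite lee_fin f0.
pose f_ := nnsfun_approx mD mEf.
have cvf x : D x -> (f_ n x)%:E @[n --> \oo] --> (f x)%:E.
  by move=> Dx; exact: (cvg_nnsfun_approx mD mEf f0').
have ndf x m n : (m <= n)%N -> (f_ m x <= f_ n x)%R.
  by move=> mn; exact/lefP/nd_nnsfun_approx.
have mfn n : measurable_fun D (f_ n) by exact: measurable_funTS.
transitivity (limn (fun n => \int[nu]_(x in D) (f_ n x)%:E)).
  rewrite -monotone_convergence//.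
  - by apply: eq_integral => y /[!inE] yD; apply/esym/cvg_lim => //; exact: cvf.
  - by move=> n; exact/measurable_EFinP.
  - by move=> n y _; rewrite lee_fin.
  - by move=> y _ m n mn; rewrite lee_fin ndf.
rewrite (_ : (fun n => \int[nu]_(x in D) (f_ n x)%:E) =
    (fun n => \int[mu]_(x in D) (f_ n x * w x)%:E)).
  rewrite -monotone_convergence//; last 3 first.
  - by move=> n; apply/measurable_EFinP; apply: measurable_funM.
  - by move=> n y _; rewrite lee_fin mulr_ge0.
  - by move=> y _ m n mn; rewrite lee_fin ler_wpM2r// ndf.
  apply: eq_integral => y /[!inE] yD; apply/cvg_lim => //.
  have := cvgeZr (erefl : (w y)%:E \is a fin_num) (cvf y yD).
  exact.
apply/funext => n.
have mpre r : measurable (f_ n @^-1` [set r]) by exact: measurable_sfunP.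
transitivity (\sum_(k \in range (f_ n)) k%:E * nu (D `&` f_ n @^-1` [set k])).
  under eq_integral do rewrite fimfunE -fsumEFin//.
  rewrite ge0_integral_fsum//; last 2 first.
  - by move=> r; apply/measurable_EFinP/measurable_funM => //; exact: measurable_indic.
  - by move=> r x _; rewrite EFinM nnfun_muleindic_ge0.
  apply: eq_fsbigr => r _.
  by rewrite integralZl_indic_nnsfun// integral_indic// setIC.
under [RHS]eq_integral => x _.
  rewrite fimfunE fsbig_finite//= mulr_suml -sumEFin -fsbig_finite//.
  over.
rewrite /= ge0_integral_fsum//; last 2 first.
- by move=> r; apply/measurable_EFinP; do 2 apply: measurable_funM => //.
- by move=> r x _; rewrite lee_fin mulr_ge0// -lee_fin EFinM nnfun_muleindic_ge0.
apply: eq_fsbigr => r /set_mem[x _ rx].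
have r0 : (0 <= r)%R by rewrite -rx.
under [RHS]eq_integral do rewrite -mulrA EFinM.
rewrite ge0_integralZl//; last 2 first.
- by apply/measurable_EFinP; apply: measurable_funM => //; exact: measurable_indic.
- by move=> y _; rewrite lee_fin mulr_ge0.
rewrite nuE; [|exact: measurableI|exact: subIsetl].
congr (_ * _); rewrite integral_mkcondr; apply: eq_integral => y _.
by rewrite patchE indicE; case: ifPn => _; rewrite ?mul1r ?mul0r.
Qed.

Lemma integral_density (f : T -> R) : measurable_fun D f ->
  \int[nu]_(x in D) (f x)%:E = \int[mu]_(x in D) (f x * w x)%:E.
Proof.
move=> mf; rewrite integralE [in RHS]integralE; congr (_ - _).

  transitivity (\int[nu]_(x in D) (Num.max (f x) 0)%:E).
    by apply: eq_integral => x _; rewrite funeposE -EFin_max.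
  rewrite ge0_integral_density//; last 2 first.
    exact: measurable_funrpos.
    by move=> x _; rewrite le_max lexx orbT.
  by apply: eq_integral => x _; rewrite funeposE -EFin_max maxr_pMl// mul0r.
transitivity (\int[nu]_(x in D) (Num.max (- f x) 0)%:E).
  by apply: eq_integral => x _; rewrite funenegE -EFinN -EFin_max.
rewrite ge0_integral_density//; last 2 first.
  exact: measurable_funrneg.
  by move=> x _; rewrite le_max lexx orbT.
by apply: eq_integral => x _; rewrite funenegE -EFinN -EFin_max maxr_pMl// mul0r mulNr.
Qed.

Lemma integrable_density (f : T -> R) : measurable_fun D f ->
  nu.-integrable D (EFin \o f) -> mu.-integrable D (fun x => (f x * w x)%:E).
Proof.
move=> mf /integrableP[_ h].
apply/integrableP; split; first by apply/measurable_EFinP/measurable_funM.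
apply: le_lt_trans h; rewrite (@ge0_integral_density (fun x => `|f x|%R))//;
  last exact: measurableT_comp.
under eq_integral do rewrite /= normrM (ger0_norm (w0 _)).
exact: lexx.
Qed.

End density.

Section layer_cake.
Local Open Scope ereal_scope.
Context {R : realType}.
Local Notation lambda := (@lebesgue_measure R).

Definition above (t a : R) : R := (t < a)%R%:R.

Lemma above_dist t a b :
  (`|above t a - above t b| = \1_(`[Num.min a b, Num.max a b[) t)%R.
Proof.
rewrite /above indicE mem_setE in_itv/= /Num.min /Num.max.
by case: (ltP a b) => ab; case: (ltP t a) => ta; case: (ltP t b) => tb //=;
  rewrite ?subrr ?subr0 ?sub0r ?normrN ?normr1 ?normr0 //; exfalso; lra.
Qed.

Lemma integral_above_dist a b :
  \int[lambda]_t `|above t a - above t b|%:E = `|a - b|%:E.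
Proof.
under eq_integral do rewrite above_dist.
rewrite integral_indic//= setIT lebesgue_measure_itv/= lte_fin /Num.min /Num.max.
case: (ltgtP a b) => [ab|ba|->].
- by rewrite ab -EFinB ltr0_norm ?subr_lt0// opprB.
- by rewrite ba -EFinB gtr0_norm ?subr_gt0.
- by rewrite ltxx subrr normr0.
Qed.

(** Subtracting [above t 0] truncates the half-line [t < a] to the interval between 0 and [a], which
    makes it integrable in [t] and gives a signed layer-cake formula. *)
Lemma above_sub0 t a :
  (above t a - above t 0 = \1_(`[0%R, a[%classic) t - \1_(`[a, 0%R[%classic) t)%R.
Proof.
rewrite /above !indicE !mem_setE !in_itv/=.
by case: (ltP t a) => ta; case: (ltP t (0%R : R)) => tb //=; rewrite ?subrr ?subr0 ?sub0r.
Qed.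

Lemma integrable_above_sub0 a :
  lambda.-integrable setT (fun t => (above t a - above t 0)%:E).
Proof.
rewrite (_ : (fun t => _) =
  (EFin \o \1_(`[0%R, a[%classic)) \- (EFin \o \1_(`[a, 0%R[%classic))).
  by apply: integrableB => //; exact: integrable_indic_itv.
by apply/funext => t /=; rewrite above_sub0.
Qed.

Lemma integral_above_sub0 a :
  \int[lambda]_t (above t a - above t 0)%:E = a%:E.
Proof.
under eq_integral do rewrite above_sub0 EFinB.
rewrite integralB//; [|exact: integrable_indic_itv..].
rewrite !integral_indic//= !setIT !lebesgue_measure_itv/= !lte_fin.
case: (ltgtP a (0%R : R)) => [a0|a0|->].
- by apply: (congr1 EFin (_ : 0 - (0 - a) = a)%R); rewrite !sub0r opprK.
- by apply: (congr1 EFin (_ : a - 0 - 0 = a)%R); rewrite !subr0.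
- by apply: (congr1 EFin (_ : 0 - 0 = 0)%R); rewrite subr0.
Qed.

Context d (T : measurableType d) (mu : {sigma_finite_measure set T -> \bar R}).

Lemma measurable_above d' (T' : measurableType d') (u v : T' -> R) :
  measurable_fun setT u -> measurable_fun setT v ->
  measurable_fun setT (fun z => above (u z) (v z)).
Proof.
move=> mu_ mv.
rewrite (_ : (fun z => _) = (fun z => if (u z < v z)%R then 1%R else 0%R : R)).
  by apply: measurable_fun_ifT => //; exact: measurable_fun_ltr.
by apply/funext => z; rewrite /above; case: ifP.
Qed.

(** Measurability in [t] is recorded along with the formula because Fatou's lemma will be applied to
    such functions [G]. *)
Lemma tonelli_above (q a b : T -> R) :
  measurable_fun setT q -> (forall x, 0 <= q x)%R ->
  measurable_fun setT a -> measurable_fun setT b ->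
  let G t := \int[mu]_x (q x * `|above t (a x) - above t (b x)|)%:E in
  measurable_fun setT (G : measurableTypeR R -> \bar R) /\
  \int[lambda]_t G t = \int[mu]_x (q x * `|a x - b x|)%:E.
Proof.
move=> mq q0 ma mb G.
pose F (p : T * measurableTypeR R) := (q p.1 * `|above p.2 (a p.1) - above p.2 (b p.1)|)%:E.
have mF : measurable_fun setT F.
  apply/measurable_EFinP; apply: measurable_funM.
    exact: (measurableT_comp mq).
  apply: measurableT_comp => //; apply: measurable_funB.
    by apply: measurable_above => //; apply: (measurableT_comp ma).
  by apply: measurable_above => //; apply: (measurableT_comp mb).
have F0 p : 0 <= F p by rewrite lee_fin mulr_ge0.
split; first exact: (measurable_fun_fubini_tonelli_G F mF F0).
rewrite /G -(fubini_tonelli (m1 := mu) (m2 := lambda) F mF F0).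
apply: eq_integral => x _; rewrite /F/=.
under eq_integral do rewrite EFinM.
rewrite ge0_integralZl ?lee_fin//; last first.
  apply/measurable_EFinP; apply: measurableT_comp => //.
  apply: measurable_funB;
    exact: (measurable_above (@measurable_id _ (measurableTypeR R) setT)).
by rewrite integral_above_dist.
Qed.

(* [f = int (1_{t<f} - 1_{t<0}) dt], and the second term contributes nothing
   against [D]. *)
Lemma fubini_above (f D : T -> R) :
  measurable_fun setT f -> mu.-integrable setT (EFin \o D) ->
  mu.-integrable setT (fun x => (f x * D x)%:E) -> \int[mu]_x (D x)%:E = 0 ->
  \int[mu]_x (f x * D x)%:E = \int[lambda]_t \int[mu]_x (above t (f x) * D x)%:E.
Proof.
move=> mf iD ifD D0.
have mD : measurable_fun setT D by apply/measurable_EFinP; case/integrableP: iD.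
pose F (p : T * measurableTypeR R) :=
  ((above p.2 (f p.1) - above p.2 0) * D p.1)%:E.
have mF : measurable_fun setT F.
  apply/measurable_EFinP; apply: measurable_funM; last exact: (measurableT_comp mD).
  apply: measurable_funB; last exact: measurable_above.
  by apply: measurable_above => //; apply: (measurableT_comp mf).
have mk a : measurable_fun setT (fun t : measurableTypeR R => (above t a - above t 0)%:E).
  by case/integrableP: (integrable_above_sub0 a).
(* Integrating [|F|] over [t] first gives [|f x * D x|], which is integrable by hypothesis. *)
have iF : (mu \x lambda).-integrable setT F.
  apply/(integrable12ltyP _ _ mF); case/integrableP: ifD => _; apply: le_lt_trans.
  rewrite le_eqVlt; apply/orP; left; apply/eqP/eq_integral => x _.
  rewrite /F/=; under eq_integral do rewrite normrM mulrC EFinM.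
  rewrite ge0_integralZl//; last first.
    by apply/measurable_EFinP; apply: measurableT_comp => //; apply/measurable_EFinP; exact: mk.
  by rewrite integral_above_dist subr0 -EFinM normrM mulrC.
transitivity (\int[mu]_x \int[lambda]_t F (x, t)).
  apply: eq_integral => x _; rewrite /F/=.
  under [RHS]eq_integral do rewrite EFinM.
  by rewrite integralZr//; [rewrite integral_above_sub0|exact: integrable_above_sub0].
rewrite (Fubini iF); apply: eq_integral => t _; rewrite /F/=.
have iab (a : T -> R) : measurable_fun setT a ->
    mu.-integrable setT (fun x => (above t (a x) * D x)%:E).
  move=> ma; apply: (le_integrable measurableT _ _ iD) => [|x _].
    apply/measurable_EFinP; apply: measurable_funM => //.
    exact: measurable_above.
  rewrite /= lee_fin normrM ler_piMl// /above; by case: (_ < _)%R; rewrite ?normr1 ?normr0.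
under eq_integral do rewrite mulrBl EFinB.
rewrite integralB//; [|exact: iab..].
rewrite [X in _ - X](_ : _ = 0) ?sube0//.
under eq_integral do rewrite EFinM.
by rewrite integralZl// D0 mule0.
Qed.

End layer_cake.

(** * Difference quotients *)

Section difference_quotients.
Context {R : realType} {d : nat}.
Local Notation lam := (lebesgue_rV d : {sigma_finite_measure set 'rV[R]_d -> \bar R}).

Lemma integrable_cube (F : 'rV[R]_d -> R) (r M : R) : measurable_fun setT F ->
  (forall x, `|F x| <= M) -> (forall x, ~ cube d r x -> F x = 0) ->
  lam.-integrable setT (EFin \o F).
Proof.
move=> mF FM F0.
have mc := @measurable_cube R d r.
have -> : EFin \o F = (EFin \o F) \_ (cube d r).
  apply/funext => x; rewrite patchE; case: ifPn => //=.
  by rewrite notin_setE => /F0 ->.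
apply/(integrable_mkcond _ mc).
apply: measurable_bounded_integrable => //.
- exact: lebesgue_rV_cube.
- exact: measurable_funTS.
- exists M; split; first exact: num_real.
  by move=> y My x _; apply: le_trans (FM x) (ltW My).
Qed.

(** Discrete integration by parts: translation invariance moves the quotient from [g] to [psi],
    where it is bounded by [M] and converges pointwise, so dominated convergence applies. The cube
    grows from [r] to [r + 1] since a translation by [h n *: v] moves each coordinate by at most
    1. *)
Lemma difference_quotient_cvg (psi dpsi g : 'rV[R]_d -> R) (v : 'rV[R]_d)
    (r M : R) (h : R^nat) :
  measurable_fun setT psi -> (forall x, `|psi x| <= M) ->
  (forall x, ~ cube d r x -> psi x = 0) ->
  (forall x, is_derive x v psi (dpsi x)) -> (forall x, `|dpsi x| <= M) ->
  (forall j, `|v 0 j| <= 1) ->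
  measurable_fun setT g -> (forall x, `|g x| <= 1) ->
  (forall n, 0 < h n <= 1) -> h n @[n --> \oo] --> (0 : R) ->
  ((\int[lam]_x (psi x * ((h n)^-1 * (g (x + h n *: v) - g x)))%:E)%E @[n --> \oo]
     --> (\int[lam]_x (- dpsi x * g x)%:E)%E).
Proof.
move=> mpsi psiM psi0 dpsiE dpsiM v1 mg g1 h01 h0.
have M0 : 0 <= M by apply: le_trans (psiM 0).
have hgt0 n : 0 < h n by case/andP: (h01 n).
have mshift (F : 'rV[R]_d -> R) (u : 'rV[R]_d) : measurable_fun setT F ->
    measurable_fun setT (fun x : 'rV[R]_d => F (x + u)).
  by move=> mF; apply: (measurableT_comp mF); exact: measurable_shift_rV.
have psi0' n (x : 'rV[R]_d) : ~ cube d (r + 1) x -> psi (x - h n *: v) = 0.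
  move=> rx; apply: psi0; apply: contra_not rx => rx j.
  have := rx j; rewrite !mxE => rxj.
  rewrite -(subrK (h n * v 0 j) (x 0 j)); apply: le_trans (ler_normD _ _) _.
  rewrite lerD// normrM; have /andP[_ hn1] := h01 n.
  by rewrite -[leRHS]mulr1 ler_pM// gtr0_norm.
have psi0'' (x : 'rV[R]_d) : ~ cube d (r + 1) x -> psi x = 0.
  move=> rx; apply: psi0; apply: contra_not rx => rx j.
  by apply: le_trans (rx j) _; rewrite lerDl.
pose f n (x : 'rV[R]_d) := ((h n)^-1 * (psi (x - h n *: v) - psi x)) * g x.
have mf n : measurable_fun setT (f n).
  apply: measurable_funM => //; apply: measurable_funM => //.
  by apply: measurable_funB => //; exact: mshift.
have fM n x : `|f n x| <= M.
  rewrite /f !normrM normfV -[leRHS]mulr1 ler_pM// mulrC ler_pdivrMr ?normr_gt0 ?gt_eqF//.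
  rewrite -scaleNr -(normrN (h n)); apply: rV_segment_bound => s _.
    by case: (dpsiE (x + s *: v)).
  by rewrite (@derive_val _ _ _ _ _ _ _ (dpsiE (x + s *: v))).
have f0 n x : ~ cube d (r + 1) x -> f n x = 0.
  by move=> rx; rewrite /f psi0'// psi0''// subrr mulr0 mul0r.
have cvf x : f n x @[n --> \oo] --> - dpsi x * g x.
  apply: cvgMl; have [dp <-] := dpsiE x.
  (* The quotient in [f n] is minus the difference quotient of [psi] at the increment [- h n], hence
     the sign of the limit. *)
  pose q (k : R) : R := k^-1 * (psi (k *: v + x) - psi x).
  have dq : q k @[k --> (0 : R)^'] --> 'D_v psi x by exact: dp.
  have /cvgN : q (- h n) @[n --> \oo] --> 'D_v psi x.
    apply: (proj1 (cvgr_dnbhsP q 0 _) dq); split; first by move=> n; rewrite oppr_eq0 gt_eqF.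
    by rewrite -oppr0; exact: cvgN.
  apply: cvg_trans; apply: near_eq_cvg; apply: nearW => n /=.
  by rewrite !fctE /q invrN mulNr opprK scaleNr [- _ + x]addrC.
have E n : (\int[lam]_x (psi x * ((h n)^-1 * (g (x + h n *: v) - g x)))%:E =
    \int[lam]_x (f n x)%:E)%E.
  have igpsi (u : 'rV[R]_d) : lam.-integrable setT (fun x => (psi x * g (x + u))%:E).
    apply: (@integrable_cube _ r M).
    - by apply: measurable_funM => //; exact: mshift.
    - by move=> x; rewrite normrM -[leRHS]mulr1 ler_pM.
    - by move=> x rx; rewrite psi0// mul0r.
  have igpsi' : lam.-integrable setT (fun x => (psi (x - h n *: v) * g x)%:E).
    apply: (@integrable_cube _ (r + 1) M).
    - by apply: measurable_funM => //; exact: mshift.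
    - by move=> x; rewrite normrM -[leRHS]mulr1 ler_pM.
    - by move=> x rx; rewrite psi0'// mul0r.
  transitivity ((h n)^-1%:E * (\int[lam]_x (psi x * g (x + h n *: v))%:E -
      \int[lam]_x (psi x * g (x + 0))%:E))%E.
    rewrite -integralB// -integralZl//; last exact: integrableB.
    apply: eq_integral => x _; rewrite addr0 -EFinB -EFinM; congr EFin; ring.
  rewrite -(@integral_rV_shift _ _ (- (h n *: v))
    (fun x => (psi x * g (x + h n *: v))%:E)); last first.
    by apply/measurable_EFinP; apply: measurable_funM => //; exact: mshift.
  under eq_integral do rewrite subrK.
  rewrite -integralB// -integralZl//; last exact: integrableB.
  by apply: eq_integral => x _; rewrite addr0 -EFinB -EFinM /f; congr EFin; ring.
under eq_cvg do rewrite E.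
apply: (@dominated_cvg _ _ _ lam setT measurableT (fun n x => (f n x)%:E)
  (fun x => (- dpsi x * g x)%:E) (fun x => (M * \1_(cube d (r + 1)) x)%:E)) => //.
- by move=> n; exact/measurable_EFinP.
- by move=> x _; apply: cvg_EFin; [exact: nearW|exact: cvf].
- apply: (@integrable_cube _ (r + 1) M).
  + by apply: measurable_funM => //; apply: measurable_indic; exact: measurable_cube.
  + move=> x; rewrite normrM ger0_norm// indicE.
    by case: (_ \in _); rewrite ?normr1 ?normr0 ?mulr1 ?mulr0.
  + by move=> x rx; rewrite indicE memNset// mulr0.
- move=> n x _; rewrite lee_fin indicE.
  have [xc|] := boolP (x \in cube d (r + 1)); first by rewrite mulr1.
  by rewrite notin_setE => xc; rewrite f0 ?normr0 ?mulr0.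
Qed.

End difference_quotients.

(** * Laguerre weights *)

Section compactness.
Context {R : realType} {d : nat}.

Lemma compact_norm_bound (A : set 'rV[R]_d) (f : 'rV[R]_d -> R) : compact A ->
  (forall x, A x -> {for x, continuous f}) -> exists M, forall x, A x -> `|f x| <= M.
Proof.
move=> cA cf.
have cfA : {within A, continuous f}.
  by apply: continuous_in_subspaceT => x /set_mem; exact: cf.
have [M [Mr HM]] := @compact_bounded R R^o _ (continuous_compact cfA cA).
exists (M + 1) => x Ax; apply: (HM (M + 1)); first by rewrite ltrDl.
by exists x.
Qed.

Lemma compact_cube (A : set 'rV[R]_d) : compact A -> exists r, A `<=` cube d r.
Proof.
move=> cA.
have /choice[M HM] : forall j, exists M, forall x, A x -> `|x 0 j| <= M.
  move=> j; apply: compact_norm_bound => // x _; exact: coord_continuous.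
exists (\sum_j `|M j|) => x Ax j; apply: le_trans (HM j x Ax) _.
by apply: le_trans (ler_norm _) _; rewrite (bigD1 j)//= lerDl sumr_ge0.
Qed.

End compactness.

Section weights.
Context {R : realType} {d : nat} (alpha : 'rV[R]_d).
Implicit Types (a t r l : R) (x : 'rV[R]_d) (i j k : 'I_d).

(* [t^a e^(-t)] for [0 < t]; junk for [t <= 0], where [ln t = 0]. *)
Definition exp_weight (a t : R) : R := expR (a * ln t - t).

Lemma exp_weight_gt0 a t : 0 < exp_weight a t.
Proof. exact: expR_gt0. Qed.

Lemma exp_weightE a t : 0 < t -> t `^ a * expR (- t) = exp_weight a t.
Proof. by move=> t0; rewrite /powR gt_eqF// -expRD. Qed.

Lemma is_derive_exp_weight a t : 0 < t ->
  is_derive t (1 : R) (exp_weight a) ((a / t - 1) * exp_weight a t).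
Proof.
move=> t0; have := is_derive1_ln t0 => dln.
have dg : is_derive t (1 : R) (fun s => a * ln s - s) (a / t - 1).
  have := is_deriveB (is_deriveZ a dln) (is_derive_id t (1 : R)).
  by apply.
have := @is_derive1_comp R expR (fun s => a * ln s - s) t _ _ (is_derive_expR _) dg.
by rewrite mulrC.
Qed.

Lemma measurable_exp_weight a : measurable_fun setT (exp_weight a).
Proof.
apply: measurableT_comp => //; apply: measurable_funB => //.
by apply: measurable_funM => //; exact: measurable_ln.
Qed.

(** On [[1, r]] the logarithm lies between 0 and [ln r], and [|a|] covers both signs of the
    exponent; the upper bound simply drops [e^(-t)]. *)
Lemma exp_weight_bounds a t r : 1 <= t -> t <= r ->
  expR (- (`|a| * ln r) - r) <= exp_weight a t <= expR (`|a| * ln r).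
Proof.
move=> t1 tr; have t0 : 0 < t by lra.
have lt0 : 0 <= ln t by exact: ln_ge0.
have ltr_ : ln t <= ln r by rewrite ler_ln// posrE; lra.
have : `|a * ln t| <= `|a| * ln r by rewrite normrM (ger0_norm lt0) ler_wpM2l.
by rewrite ler_norml /exp_weight !ler_expR => /andP[h1 h2]; lra.
Qed.

Definition laguerre_const : R := \prod_(j < d) (Gamma (alpha 0 j + 1))^-1.

Lemma laguerre_const_ge0 : 0 <= laguerre_const.
Proof. by apply: prodr_ge0 => j _; rewrite invr_ge0 Gamma_ge0. Qed.

Lemma laguerre_densityE (x : 'rV[R]_d) : pos_orthant x ->
  laguerre_density alpha x = laguerre_const * \prod_j exp_weight (alpha 0 j) (x 0 j).
Proof.
move=> x0; rewrite /laguerre_density /laguerre_const -big_split/=.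
by apply: eq_bigr => j _; rewrite exp_weightE// mulrC.
Qed.

Lemma laguerre_measure_density (A : set 'rV[R]_d) : A `<=` pos_orthant ->
  laguerre_measure alpha A =
  (\int[lebesgue_rV d]_(x in A) (laguerre_density alpha x)%:E)%E.
Proof. by move=> /setIidPl; rewrite /laguerre_measure => ->. Qed.

(** The density without its factor in coordinate [i]. It is constant along [e_i], so only a
    one-variable weight matters for derivatives and primitives in that direction. *)
Definition transverse_weight (i : 'I_d) (x : 'rV[R]_d) : R :=
  laguerre_const * \prod_(j | j != i) exp_weight (alpha 0 j) (x 0 j).

(* [laguerre_density * delta_star i g] is minus the [i]-th partial derivative of
   [flux_weight i * g]. *)
Definition flux_weight (i : 'I_d) (x : 'rV[R]_d) : R :=
  exp_weight (alpha 0 i + 2^-1) (x 0 i) * transverse_weight i x.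

Lemma flux_weightE i x : pos_orthant x ->
  Num.sqrt (x 0 i) * laguerre_density alpha x = flux_weight i x.
Proof.
move=> x0; rewrite laguerre_densityE// (bigD1 i)//= /flux_weight /transverse_weight.
rewrite -[in RHS]exp_weightE// powRD; last by apply/implyP => _; exact: lt0r_neq0.
rewrite (powR12_sqrt (ltW (x0 i))) -exp_weightE//; ring.
Qed.

Lemma transverse_weight_ge0 i x : 0 <= transverse_weight i x.
Proof.
rewrite mulr_ge0 ?laguerre_const_ge0 ?prodr_ge0// => j _; exact/ltW/exp_weight_gt0.
Qed.

Lemma flux_weight_ge0 i x : 0 <= flux_weight i x.
Proof. by rewrite mulr_ge0 ?transverse_weight_ge0// ltW ?exp_weight_gt0. Qed.

Lemma measurable_flux_weight i : measurable_fun setT (flux_weight i).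
Proof.
have mc a j : measurable_fun setT (fun x : 'rV[R]_d => exp_weight a (x 0 j)).
  by apply: (measurableT_comp (measurable_exp_weight a)); exact: measurable_rV_coord.
apply: measurable_funM; first exact: mc.
apply: measurable_funM => //.
rewrite (_ : (fun x => _) = fun x : 'rV[R]_d =>
    \prod_j (if j != i then exp_weight (alpha 0 j) (x 0 j) else 1)).
  by apply: measurable_prod => j _; case: (j != i) => //; exact: mc.
by apply/funext => x; rewrite big_mkcond.
Qed.

Lemma transverse_weight_line i x t :
  transverse_weight i (x + t *: (delta_mx 0 i : 'rV[R]_d)) = transverse_weight i x.
Proof.
congr (_ * _); apply: eq_bigr => j ji; congr exp_weight.
by rewrite !mxE eqxx/= (negbTE ji) mulr0 addr0.
Qed.

Lemma is_derive_coord (a : R -> R) (x : 'rV[R]_d) (i k : 'I_d) l :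
  is_derive (x 0 i) (1 : R) a l ->
  is_derive x (delta_mx 0 k : 'rV[R]_d) (fun y : 'rV[R]_d => a (y 0 i))
    (if i == k then l else 0).
Proof.
move=> da; have /(_ x (delta_mx 0 k) 0 (if i == k then l else 0)) :=
  @is_derive_line R _ (fun y : 'rV[R]_d => a (y 0 i)).
rewrite scale0r addr0 => H; apply/H => {H}.
under eq_fun do rewrite !mxE eqxx/=.
case: eqVneq => [_|_]; last first.
  under eq_fun do rewrite mulr0 addr0.
  exact: is_derive_cst.
have -> : (fun s : R => a (x 0 i + s * true%:R)) = a \o shift (x 0 i).
  by apply/funext => s /=; rewrite mulr1 addrC.
have := @is_derive1_comp R a (shift (x 0 i)) 0 l 1.
rewrite mulr1 /shift/= add0r; apply => //.
have := is_deriveD (is_derive_id (0 : R) (1 : R)) (is_derive_cst (x 0 i) (0 : R) (1 : R)).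
by rewrite addr0.
Qed.

Lemma is_derive_flux_weight i x : pos_orthant x ->
  is_derive x (delta_mx 0 i : 'rV[R]_d) (flux_weight i)
    ((alpha 0 i + 2^-1 - x 0 i) / x 0 i * flux_weight i x).
Proof.
move=> x0.
have d1 := is_derive_coord i (is_derive_exp_weight (alpha 0 i + 2^-1) (x0 i)).
have d2 : is_derive x (delta_mx 0 i : 'rV[R]_d) (transverse_weight i) 0.
  have /(_ x (delta_mx 0 i) 0 0) := @is_derive_line R _ (transverse_weight i).
  rewrite scale0r addr0 => H; apply/H => {H}.
  under eq_fun do rewrite transverse_weight_line.
  exact: is_derive_cst.
have d12 := is_deriveM d1 d2; apply: (is_derive_eq (f := flux_weight i) d12).
rewrite eqxx scaler0 add0r /flux_weight.
rewrite /GRing.scale/=; field; exact: lt0r_neq0.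
Qed.

Lemma flux_weight_bound i r : exists M, forall x : 'rV[R]_d,
  (forall j, 1 <= x 0 j) -> cube d r x -> flux_weight i x <= M.
Proof.
exists (expR (`|alpha 0 i + 2^-1| * ln r) *
  (laguerre_const * \prod_(j | j != i) expR (`|alpha 0 j| * ln r))) => x x1 xr.
have b a j : exp_weight a (x 0 j) <= expR (`|a| * ln r).
  have xj : x 0 j <= r by apply: le_trans (xr j); exact: ler_norm.
  by have /andP[] := exp_weight_bounds a (x1 j) xj.
apply: ler_pM => //; first exact/ltW/exp_weight_gt0.
  exact: transverse_weight_ge0.
rewrite ler_wpM2l ?laguerre_const_ge0//; apply: ler_prod => j _.
by rewrite b ltW ?exp_weight_gt0.
Qed.

(** Needed to trade integrability for the Laguerre measure against Lebesgue integrability on bounded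
    sets. *)
Lemma laguerre_density_lower_bound r : exists2 c, 0 < c & forall x : 'rV[R]_d,
  (forall j, 1 <= x 0 j) -> cube d r x -> laguerre_const * c <= laguerre_density alpha x.
Proof.
exists (\prod_j expR (- (`|alpha 0 j| * ln r) - r)).
  by apply: prodr_gt0 => j _; exact: expR_gt0.
move=> x x1 xr; rewrite laguerre_densityE; last by move=> j; apply: lt_le_trans (x1 j).
rewrite ler_wpM2l ?laguerre_const_ge0//; apply: ler_prod => j _.
have xj : x 0 j <= r by apply: le_trans (xr j); exact: ler_norm.
by have /andP[-> _] := exp_weight_bounds (alpha 0 j) (x1 j) xj; rewrite expR_ge0.
Qed.

End weights.

(** * Flux of a test field *)

Section flux.
Context {R : realType} {d : nat} (alpha : 'rV[R]_d) (U : set 'rV[R]_d).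
Implicit Types (x : 'rV[R]_d) (i j k : 'I_d) (phi : 'rV[R]_d -> 'rV[R]_d).
Hypotheses (oU : open U) (U1 : forall x, U x -> forall i, 1 < x 0 i).
Local Notation lam := (lebesgue_rV d : {sigma_finite_measure set 'rV[R]_d -> \bar R}).

Lemma subset_pos_orthant : U `<=` pos_orthant.
Proof. by move=> x Ux i; apply: lt_trans (U1 Ux i). Qed.

(** The [i]-th derivative of the weighted component divided by [flux_weight]: the coefficient of
    [phi] is the logarithmic derivative of that weight along [e_i]. *)
Definition log_divergence phi i x : R :=
  partial i (fun y => phi y 0 i) x +
    (alpha 0 i + 2^-1 - x 0 i) / x 0 i * phi x 0 i.

(** Values of [phi] outside [U] carry no meaning. Extension by zero gives a function on the whole
    space, where translations are available. *)
Definition flux phi i : 'rV[R]_d -> R :=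
  (fun x => flux_weight alpha i x * phi x 0 i) \_ U.

Definition dflux phi i : 'rV[R]_d -> R :=
  (fun x => flux_weight alpha i x * log_divergence phi i x) \_ U.

Lemma delta_starE phi i x :
  delta_star alpha i (fun y => phi y 0 i) x = - (Num.sqrt (x 0 i) * log_divergence phi i x).
Proof. by rewrite /delta_star mulNr. Qed.

Lemma measurable_patch (f : 'rV[R]_d -> R) : measurable_fun U f ->
  measurable_fun setT (f \_ U).
Proof. by move/(measurable_restrictT f (open_measurable_rV oU)). Qed.

Section test_field.
Variable phi : 'rV[R]_d -> 'rV[R]_d.
Hypothesis phiU : test_fields U phi.

Let C1phi i : C1_on U (fun y => phi y 0 i).
Proof. by case: phiU. Qed.

Let S := closure [set x | U x /\ phi x != 0].

Let cS : compact S. Proof. by case: phiU => _ []. Qed.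
Let SU : S `<=` U. Proof. by case: phiU => _ []. Qed.

Lemma test_field_continuous i x : U x -> {for x, continuous (fun y => phi y 0 i)}.
Proof. exact: C1_continuous. Qed.

Lemma test_field_le1 i x : U x -> `|phi x 0 i| <= 1.
Proof.
move=> Ux; case: phiU => _ _ /(_ x Ux); apply: le_trans.
rewrite -[leLHS]ger0_norm// -sqrtr_sqr ler_sqrt; last by rewrite sumr_ge0.
by rewrite (bigD1 i)//= lerDl sumr_ge0.
Qed.

Lemma log_divergence_continuous i x : U x -> {for x, continuous (log_divergence phi i)}.
Proof.
move=> Ux; have [_ cp] := C1phi i i Ux.
have cx : {for x, continuous (fun y : 'rV[R]_d => y 0 i)} by exact: coord_continuous.
apply: (@cvgD _ _ _ (nbhs x)) => //.
apply: (@cvgM _ _ (nbhs x)); last exact: test_field_continuous.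
apply: (@cvgM _ _ (nbhs x)).
  by apply: (@cvgB _ _ _ (nbhs x)) => //; exact: cvg_cst.
apply: (@cvgV _ _ (nbhs x)) => //.
by rewrite gt_eqF// subset_pos_orthant.
Qed.

Lemma off_support x : U x -> ~ S x -> phi x = 0.
Proof.
move=> Ux Sx; apply/eqP/negPn/negP => px; apply: Sx.
by apply: subset_closure; split.
Qed.

Lemma near_off_support x : ~ S x -> \forall y \near x, ~ S y.
Proof.
move=> Sx; apply: (@open_nbhs_nbhs _ x (~` S)); split => //.
exact/closed_openC/closed_closure.
Qed.

Lemma log_divergence_off_support i x : U x -> ~ S x -> log_divergence phi i x = 0.
Proof.
move=> Ux Sx; rewrite /log_divergence off_support// mxE mulr0 addr0.
rewrite /partial (@near_eq_derive _ _ _ _ (cst 0)) ?derive_cst//.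
have nU : nbhs x U by exact: open_nbhs_nbhs.
have nS := near_off_support Sx.
by near=> y; rewrite off_support ?mxE//; near: y.
Unshelve. all: by end_near. Qed.

Lemma flux_off_support i x : ~ S x -> flux phi i x = 0.
Proof.
move=> Sx; rewrite /flux patchE; case: ifPn => // /set_mem Ux.
by rewrite off_support// mxE mulr0.
Qed.

Lemma dflux_off_support i x : ~ S x -> dflux phi i x = 0.
Proof.
move=> Sx; rewrite /dflux patchE; case: ifPn => // /set_mem Ux.
by rewrite log_divergence_off_support// mulr0.
Qed.

(** On the support, which lies inside the open set [U], this is the product rule; off the support, a
    closed set, [flux] vanishes in a neighbourhood. *)
Lemma is_derive_flux i x :
  is_derive x (delta_mx 0 i : 'rV[R]_d) (flux phi i) (dflux phi i x).
Proof.
have [Sx|Sx] := pselect (S x); last first.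
  rewrite dflux_off_support//; apply: (near_eq_is_derive (f := cst 0)).
    have nS := near_off_support Sx.
    by near=> y; rewrite flux_off_support//; near: y.
have Ux := SU Sx; have nU : nbhs x U by exact: open_nbhs_nbhs.
apply: (near_eq_is_derive (f := (flux_weight alpha i * (fun y => phi y 0 i))%R)).
  near=> y; rewrite /flux patchE mem_set//; near: y; exact: nU.
have [/derivableP dphi _] := C1phi i i Ux.
have := is_deriveM (is_derive_flux_weight alpha i (subset_pos_orthant Ux)) dphi.
move/is_derive_eq; apply.
rewrite /dflux patchE mem_set// /log_divergence /partial /GRing.scale/=; ring.
Unshelve. all: by end_near. Qed.

Lemma measurable_flux i : measurable_fun setT (flux phi i).
Proof.
apply: measurable_patch; apply: measurable_funM.
  by apply: measurable_funTS; exact: measurable_flux_weight.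
by apply: open_continuous_measurable_rV => // x; exact: test_field_continuous.
Qed.

Lemma measurable_dflux i : measurable_fun setT (dflux phi i).
Proof.
apply: measurable_patch; apply: measurable_funM.
  by apply: measurable_funTS; exact: measurable_flux_weight.
by apply: open_continuous_measurable_rV => // x; exact: log_divergence_continuous.
Qed.

Lemma flux_bounds : exists r M, forall i,
  [/\ forall x, ~ cube d r x -> flux phi i x = 0,
      forall x, ~ cube d r x -> dflux phi i x = 0,
      forall x, `|flux phi i x| <= M & forall x, `|dflux phi i x| <= M].
Proof.
have [r Sr] := compact_cube cS.
have /choice[M HM] : forall i, exists M, 0 <= M /\ forall x, S x -> flux_weight alpha i x <= M.
  move=> i; have [M HM] := flux_weight_bound alpha i r.
  exists (Num.max 0 M); split; first by rewrite le_max lexx.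
  move=> x Sx; rewrite le_max HM ?orbT//; last exact: Sr.
  by move=> j; apply/ltW/U1/SU.
have /choice[N HN] : forall i, exists N, forall x, S x -> `|log_divergence phi i x| <= N.
  move=> i; apply: compact_norm_bound => // x Sx.
  by apply: log_divergence_continuous; exact: SU.
(* One bound for everything: in [1 + |N i|] the 1 covers the components of [phi], the other term
   covers [log_divergence], and the sum removes the dependence on [i]. *)
exists r; exists (\sum_i (M i * (1 + `|N i|))) => i.
have M0 k : 0 <= M k * (1 + `|N k|) by rewrite mulr_ge0 ?addr_ge0//; case: (HM k).
have le x a : S x -> `|a| <= 1 + `|N i| ->
    `|flux_weight alpha i x * a| <= \sum_i (M i * (1 + `|N i|)).
  move=> Sx aN; rewrite (bigD1 i)//=; apply: ler_wpDr; first by rewrite sumr_ge0.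
  rewrite normrM ger0_norm ?flux_weight_ge0// ler_pM ?flux_weight_ge0//.
  by case: (HM i) => _; exact.
have sum0 : 0 <= \sum_i (M i * (1 + `|N i|)) by rewrite sumr_ge0.
split=> x.
- by move=> rx; rewrite flux_off_support//; apply: contra_not rx => /Sr.
- by move=> rx; rewrite dflux_off_support//; apply: contra_not rx => /Sr.
- have [Sx|Sx] := pselect (S x); last by rewrite flux_off_support// normr0.
  rewrite /flux patchE mem_set; last exact: SU.
  apply: le => //; apply: ler_wpDr => //; exact/test_field_le1/SU.
- have [Sx|Sx] := pselect (S x); last by rewrite dflux_off_support// normr0.
  rewrite /dflux patchE mem_set; last exact: SU.
  apply: le => //; apply: le_trans (HN i x Sx) _.
  by apply: ler_wpDl => //; exact: ler_norm.
Qed.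

Definition flux_divergence x : R := - \sum_i dflux phi i x.

Lemma div_laguerre_density x : U x ->
  div_laguerre alpha phi x * laguerre_density alpha x = flux_divergence x.
Proof.
move=> Ux; rewrite /div_laguerre /flux_divergence mulr_suml -sumrN.
apply: eq_bigr => i _; rewrite delta_starE /dflux patchE mem_set//.
by rewrite -flux_weightE; [ring|exact: subset_pos_orthant].
Qed.

Lemma measurable_flux_divergence : measurable_fun setT flux_divergence.
Proof.
apply: measurableT_comp => //; apply: measurable_sum => i; exact: measurable_dflux.
Qed.

Lemma measurable_div_laguerre : measurable_fun U (div_laguerre alpha phi).
Proof.
apply: measurable_sum => i; rewrite (_ : delta_star _ _ _ =
    fun x => - (Num.sqrt (x 0 i) * log_divergence phi i x)); last first.
  by apply/funext => x; exact: delta_starE.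
apply: measurableT_comp => //; apply: measurable_funM.
  apply: measurable_funTS.
  have ms : measurable_fun setT (@Num.sqrt R).
    by apply: continuous_measurable_fun; exact: sqrt_continuous.
  by apply: (measurableT_comp ms); exact: measurable_rV_coord.
by apply: open_continuous_measurable_rV => // x; exact: log_divergence_continuous.
Qed.

(** Passes from the Laguerre measure on [U] to Lebesgue measure on the whole space, which is
    translation invariant. *)
Lemma integral_div_laguerre (g : 'rV[R]_d -> R) : measurable_fun U g ->
  (\int[laguerre_measure alpha]_(x in U) (g x * div_laguerre alpha phi x)%:E =
   \int[lam]_x ((g \_ U) x * flux_divergence x)%:E)%E.
Proof.
move=> mg; have mU := open_measurable_rV oU.
rewrite (@integral_density _ _ _ _ lam U (laguerre_density alpha))//.
- rewrite integral_mkcond; apply: eq_integral => x _; rewrite !patchE.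
  by case: ifPn => [/set_mem Ux|_]; rewrite ?mul0r// -mulrA div_laguerre_density.
- by apply: measurable_funTS; exact: measurable_laguerre_density.
- exact: laguerre_density_ge0.
- move=> A mA AU; apply: laguerre_measure_density.
  exact: subset_trans AU subset_pos_orthant.
- by apply: measurable_funM => //; exact: measurable_div_laguerre.
Qed.

End test_field.
End flux.

(** * Upper bound by the perimeters and lower semicontinuity *)

Lemma cvg_le_limn_einf (R : realType) (u v : (\bar R)^nat) (l : \bar R) :
  u @ \oo --> l -> (\forall n \near \oo, (u n <= v n)%E) -> (l <= limn_einf v)%E.
Proof.
move=> ul uv; rewrite -(cvg_limn_einf_sup ul).1 !limn_einf_lim.
apply: lee_lim; [exact: is_cvg_einfs|exact: is_cvg_einfs|].
case: uv => N _ uv; exists N => // n /= Nn.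
apply: le_ereal_inf_tmp => _ [m /= nm <-].
apply: (@le_trans _ _ (u m)); last by apply: uv; exact: leq_trans nm.
by apply: ereal_inf_lbound; exists m.
Qed.

Section coarea_bounds.
Context {R : realType} {d : nat} (alpha : 'rV[R]_d) (U : set 'rV[R]_d).
Implicit Types (x : 'rV[R]_d) (i j k : 'I_d) (phi : 'rV[R]_d -> 'rV[R]_d).
Hypotheses (oU : open U) (U1 : forall x, U x -> forall i, 1 < x 0 i).
Local Notation lam := (lebesgue_rV d : {sigma_finite_measure set 'rV[R]_d -> \bar R}).
Local Notation mu := (laguerre_measure alpha).

(** On the cube that supports [q] the density is at least the positive number [cc], so [|f * q|] is
    dominated there by [M / cc] times [|f|] times the density. *)
Lemma integrable_patch_mul (f q : 'rV[R]_d -> R) (r M : R) :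
  0 < laguerre_const alpha -> mu.-integrable U (EFin \o f) ->
  measurable_fun setT q -> (forall x, `|q x| <= M) ->
  (forall x, ~ cube d r x -> q x = 0) ->
  lam.-integrable setT (fun x => ((f \_ U) x * q x)%:E).
Proof.
move=> c0 fi mq qM q0; have mU := open_measurable_rV oU.
have mf : measurable_fun U f by apply/measurable_EFinP; case/integrableP: fi.
have [c cgt0 cle] := laguerre_density_lower_bound alpha r.
set cc := laguerre_const alpha * c; have ccgt0 : 0 < cc by exact: mulr_gt0.
have fwi : lam.-integrable U (fun x => (f x * laguerre_density alpha x)%:E).
  apply: (integrable_density (nu := mu)) => //.
  - by apply: measurable_funTS; exact: measurable_laguerre_density.
  - exact: laguerre_density_ge0.
  - move=> A mA AU; apply: laguerre_measure_density.
    exact: subset_trans AU (subset_pos_orthant U1).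
move/(integrable_mkcond _ mU) : fwi => /(integrableZl measurableT (M / cc)).
apply: le_integrable => //.
  by apply/measurable_EFinP; apply: measurable_funM => //; exact: (measurable_patch oU mf).
move=> x _ /=; rewrite !patchE; case: ifPn => [/set_mem Ux|_]; last first.
  by rewrite mul0r normr0 abse_ge0.
have M0 : 0 <= M by apply: le_trans (qM 0).
have [xr|xr] := pselect (cube d r x); last by rewrite q0// mulr0 normr0 abse_ge0.
rewrite -EFinM /= lee_fin !normrM.
rewrite (ger0_norm M0) (ger0_norm (laguerre_density_ge0 _ _)) normfV (gtr0_norm ccgt0).
have h : cc <= laguerre_density alpha x.
  by apply: cle => // j; exact/ltW/U1.
rewrite [leRHS]mulrCA ler_wpM2l//; apply: le_trans (qM x) _.
by rewrite -mulrA ler_peMr// mulrC ler_pdivlMr// mul1r.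
Qed.

Section fixed_test_field.
Variable phi : 'rV[R]_d -> 'rV[R]_d.
Hypothesis phiU : test_fields U phi.
Local Notation D := (flux_divergence alpha U phi).

Lemma dir_norm1 i j : `|(delta_mx 0 i : 'rV[R]_d) 0 j| <= 1.
Proof. by rewrite mxE eqxx/=; case: eqP; rewrite ?normr1 ?normr0. Qed.

Lemma flux_difference_quotient_cvg i (g : 'rV[R]_d -> R) (h : R^nat) :
  measurable_fun setT g -> (forall x, `|g x| <= 1) ->
  (forall n, 0 < h n <= 1) -> h n @[n --> \oo] --> (0 : R) ->
  ((\int[lam]_x (flux alpha U phi i x *
      ((h n)^-1 * (g (x + h n *: delta_mx 0 i) - g x)))%:E)%E @[n --> \oo]
     --> (\int[lam]_x (- dflux alpha U phi i x * g x)%:E)%E).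
Proof.
move=> mg g1 h01 h0; have [r [M /(_ i)[f0 df0 fM dfM]]] := flux_bounds alpha oU U1 phiU.
apply: (difference_quotient_cvg (r := r) (M := M)) => //.
- exact: measurable_flux.
- by move=> x; exact: is_derive_flux.
- exact: dir_norm1.
Qed.

Lemma integrable_dflux_mul i (g : 'rV[R]_d -> R) : measurable_fun setT g ->
  (forall x, `|g x| <= 1) -> lam.-integrable setT (fun x => (- dflux alpha U phi i x * g x)%:E).
Proof.
move=> mg g1; have [r [M /(_ i)[f0 df0 fM dfM]]] := flux_bounds alpha oU U1 phiU.
apply: (@integrable_cube _ _ _ r M).
- by apply: measurable_funM => //; apply: measurableT_comp => //; exact: measurable_dflux.
- by move=> x; rewrite normrM normrN -[leRHS]mulr1 ler_pM.
- by move=> x /df0 ->; rewrite oppr0 mul0r.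
Qed.

Lemma integral_flux_divergence_mul (g : 'rV[R]_d -> R) : measurable_fun setT g ->
  (forall x, `|g x| <= 1) ->
  (\int[lam]_x (g x * D x)%:E = \sum_i \int[lam]_x (- dflux alpha U phi i x * g x)%:E)%E.
Proof.
move=> mg g1; rewrite -integral_sum//; last by move=> i; exact: integrable_dflux_mul.
apply: eq_integral => x _; rewrite sumEFin; congr EFin.
by rewrite /flux_divergence -sumrN mulr_sumr; apply: eq_bigr => i _; rewrite mulrC.
Qed.

Lemma integrable_flux_divergence : lam.-integrable setT (EFin \o D).
Proof.
rewrite (_ : _ \o _ = fun x => (\sum_i (- dflux alpha U phi i x * 1)%:E)%E).
  apply: integrable_sum => // i _.
  by apply: (@integrable_dflux_mul i (cst 1)) => // x; rewrite normr1.
apply/funext => x; rewrite /= sumEFin /flux_divergence -sumrN; congr EFin.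
by apply: eq_bigr => i _; rewrite mulr1.
Qed.

Lemma integrable_patch_flux_divergence (f : 'rV[R]_d -> R) :
  0 < laguerre_const alpha -> mu.-integrable U (EFin \o f) ->
  lam.-integrable setT (fun x => ((f \_ U) x * D x)%:E).
Proof.
move=> c0 fi; have [r [M HM]] := flux_bounds alpha oU U1 phiU.
apply: (@integrable_patch_mul f _ r (\sum_(i < d) M)) => //.
- exact: measurable_flux_divergence.
- move=> x; rewrite /flux_divergence normrN; apply: le_trans (ler_norm_sum _ _ _) _.
  by apply: ler_sum => i _; case: (HM i).
- move=> x rx; rewrite /flux_divergence big1 ?oppr0// => i _.
  by case: (HM i) => _ + _ _; exact.
Qed.

(** The limit formula for difference quotients is applied to the constant function 1, whose
    quotients vanish identically. *)
Lemma integral_flux_divergence : (\int[lam]_x (D x)%:E = 0)%E.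
Proof.
have n1 x : `|cst (1 : R) x| <= 1 by rewrite normr1.
transitivity (\int[lam]_x (cst 1 x * D x)%:E)%E.
  by apply: eq_integral => x _; rewrite mul1r.
rewrite integral_flux_divergence_mul//; apply: big1 => i _.
have h01 n : 0 < (n.+1%:R^-1 : R) <= 1 by rewrite invr_gt0 ltr0n/= invf_le1// ler1n.
have := @flux_difference_quotient_cvg i (cst 1) harmonic (measurable_cst _) n1 h01
  (@cvg_harmonic R).
under eq_cvg do under eq_integral do rewrite subrr !mulr0.
under eq_cvg do rewrite integral0.
move=> /(cvg_lim (@ereal_hausdorff R)) <-.
exact: (cvg_lim (@ereal_hausdorff R) (cvg_cst _)).
Qed.

(** The flux is at most [flux_weight] in absolute value, and on the support of [phi] the factor
    [K * chi n] exceeds 1 from some [n] on. That threshold depends on [phi], but the liminf does not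
    see it, so the bound is uniform over all test fields. *)
Lemma flux_divergence_le (g : 'rV[R]_d -> R) (chi : nat -> 'rV[R]_d -> R) (h : R^nat) (K : R) :
  measurable_fun setT g -> (forall x, `|g x| <= 1) ->
  (forall n, 0 < h n <= 1) -> h n @[n --> \oo] --> (0 : R) ->
  (forall n, measurable_fun setT (chi n)) -> (forall n x, 0 <= chi n x) -> 0 <= K ->
  (forall A, compact A -> A `<=` U -> \forall n \near \oo, forall x, A x -> 1 <= K * chi n x) ->
  (\int[lam]_x (g x * D x)%:E <= \sum_i limn_einf (fun n =>
    \int[lam]_x (K * (h n)^-1 * (chi n x * flux_weight alpha i x) *
      `|g (x + h n *: delta_mx 0 i) - g x|)%:E))%E.
Proof.
move=> mg g1 h01 h0 mchi chi0 K0 Kchi.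
rewrite integral_flux_divergence_mul//; apply: lee_sum => i _.
apply: cvg_le_limn_einf; first exact: flux_difference_quotient_cvg h01 h0.
have [_ [cS SU] _] := phiU; set S := closure _ in cS SU.
have := Kchi S cS SU; apply: filterS => n Kn.
have hn0 : 0 < h n by case/andP: (h01 n).
have cW0 x : 0 <= K / h n * (chi n x * flux_weight alpha i x).
  apply: mulr_ge0; last by apply: mulr_ge0 => //; exact: flux_weight_ge0.
  by apply: divr_ge0 => //; exact: ltW.
apply: le_integral_ge0r => [x|x]; rewrite lee_fin.
  exact: mulr_ge0 (cW0 x) (normr_ge0 _).
apply: le_trans (ler_norm _) _; rewrite !normrM normfV (gtr0_norm hn0).
have [Sx|Sx] := pselect (S x); last first.
  rewrite flux_off_support// normr0 mul0r.
  exact: mulr_ge0 (cW0 x) (normr_ge0 _).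
rewrite /flux patchE mem_set; last exact: SU.
rewrite normrM (ger0_norm (flux_weight_ge0 _ _ _)).
rewrite [leLHS]mulrCA [leRHS](_ : _ = (h n)^-1 *
  (flux_weight alpha i x * (K * chi n x) * `|g (x + h n *: delta_mx 0 i) - g x|)); last by ring.
rewrite ler_wpM2l ?invr_ge0 ?(ltW hn0)// ler_wpM2r// ler_wpM2l ?flux_weight_ge0//.
by apply: le_trans (Kn x Sx); apply: test_field_le1 phiU _ _ _; exact: SU.
Qed.

(** Agreement on [U] suffices because the flux divergence vanishes outside [U]. *)
Lemma perimeter_integral (E : set 'rV[R]_d) (g : 'rV[R]_d -> R) : measurable E ->
  (forall x, U x -> \1_E x = g x) ->
  (\int[mu]_(x in U) (\1_E x * div_laguerre alpha phi x)%:E =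
   \int[lam]_x (g x * D x)%:E)%E.
Proof.
move=> mE Eg; rewrite (integral_div_laguerre alpha oU U1 phiU); last first.
  by apply: measurable_funTS; exact: measurable_indic.
apply: eq_integral => x _; rewrite patchE; case: ifPn => [/set_mem/Eg -> //|].
move=> Ux; rewrite mul0r /flux_divergence big1 ?oppr0 ?mulr0// => i _.
by rewrite /dflux patchE (negbTE Ux).
Qed.

End fixed_test_field.

Lemma test_fields0 : test_fields U (cst 0).
Proof.
split.
- move=> j i x Ux; split.
    rewrite (_ : (fun x => _) = cst 0); first exact: derivable_cst.
    by apply/funext => y; rewrite /= mxE.
  rewrite (_ : partial _ _ = cst 0); first exact: cst_continuous.
  apply/funext => y; rewrite /partial (_ : (fun x => _) = cst 0) ?derive_cst//.
  by apply/funext => z; rewrite /= mxE.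
- rewrite /compactly_supported_in (_ : [set x | _] = set0).
    by rewrite closure0; split; [exact: compact0|exact: sub0set].
  by apply/seteqP; split => // x [_]; rewrite eqxx.
- move=> x Ux; rewrite big1 ?sqrtr0// => j _.
  by rewrite mxE normr0 expr0n.
Qed.

Lemma laguerre_variation_ge0 f : (0 <= laguerre_variation alpha U f)%E.
Proof.
apply: ereal_sup_ubound; exists (cst 0); first exact: test_fields0.
apply: integral0_eq => x Ux; rewrite (_ : div_laguerre _ _ _ = 0) ?mulr0//.
rewrite /div_laguerre big1// => i _; rewrite /delta_star /partial.
rewrite (_ : (fun y => _) = cst 0); last by apply/funext => y; rewrite /= mxE.
by rewrite derive_cst mxE mulr0 addr0 mulr0.
Qed.

Lemma measurable_superlevel (f : 'rV[R]_d -> R) t : measurable_fun U f ->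
  measurable [set x | U x /\ f x > t].
Proof.
move=> mf; have := mf (open_measurable_rV oU) `]t, +oo[%classic (measurable_itv _).
rewrite (_ : U `&` _ = [set x | U x /\ f x > t])//.
by apply/seteqP; split => x [Ux]; rewrite /= in_itv/= andbT.
Qed.

Lemma indic_superlevel (f : 'rV[R]_d -> R) t x : U x ->
  \1_[set x | U x /\ f x > t] x = above t ((f \_ U) x).
Proof.
move=> Ux; rewrite indicE /above patchE (mem_set Ux).
suff -> : (x \in [set x | U x /\ f x > t]) = (t < f x) by [].
by apply/idP/idP => [/set_mem[]//|tf]; apply/mem_set.
Qed.

Lemma variation_le_perimeter_integral (f : 'rV[R]_d -> R) :
  0 < laguerre_const alpha -> mu.-integrable U (EFin \o f) ->
  (laguerre_variation alpha U f <= \int[@lebesgue_measure R]_t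
     laguerre_perimeter alpha [set x | U x /\ (f x > t)%R] U)%E.
Proof.
move=> c0 fi.
have mf : measurable_fun U f by apply/measurable_EFinP; case/integrableP: fi.
apply: ge_ereal_sup => _ [phi phiU <-].
rewrite (integral_div_laguerre alpha oU U1 phiU)//.
rewrite (fubini_above (mu := lam)).
(* The perimeter is a supremum over an uncountable family, with no measurability in [t] established;
   this comparison works from its nonnegativity. *)
- apply: le_integral_ge0r => t; first exact: laguerre_variation_ge0.
  rewrite -(perimeter_integral phiU (measurable_superlevel t mf)); last exact: indic_superlevel.
  by apply: ereal_sup_ubound; exists phi.
- exact: (measurable_patch oU mf).
- exact: integrable_flux_divergence.
- exact: integrable_patch_flux_divergence.
- exact: integral_flux_divergence.
Qed.

End coarea_bounds.

(** * Sums of products of one-variable functions *)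

Section C1_real.
Context {R : realType}.
Implicit Types (a b : R -> R) (t u : R).

Definition C1_real a : Prop := exists da : R -> R,
  continuous da /\ forall t, is_derive t (1 : R) a (da t).

Lemma C1_real_continuous a : C1_real a -> continuous a.
Proof.
move=> [da [_ ada]] t; apply/differentiable_continuous/derivable1_diffP.
by case: (ada t).
Qed.

Lemma C1_real_cst (c : R) : C1_real (fun=> c).
Proof.
exists (fun=> 0); split; first by move=> t; exact: cvg_cst.
by move=> t; exact: is_derive_cst.
Qed.

Lemma C1_real_id : C1_real id.
Proof.
exists (fun=> 1); split; first by move=> t; exact: cvg_cst.
by move=> t; exact: is_derive_id.
Qed.

Lemma C1_realD a b : C1_real a -> C1_real b -> C1_real (fun t => a t + b t).
Proof.
move=> [da [ca ada]] [db [cb bdb]]; exists (fun t => da t + db t); split.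
  by move=> t; apply: cvgD; [exact: ca|exact: cb].
by move=> t; exact: is_deriveD.
Qed.

Lemma C1_realM a b : C1_real a -> C1_real b -> C1_real (fun t => a t * b t).
Proof.
move=> Ca Cb; have cca := C1_real_continuous Ca; have ccb := C1_real_continuous Cb.
case: Ca Cb => [da [ca ada]] [db [cb bdb]].
exists (fun t => a t * db t + b t * da t); split.
  by move=> t; apply: cvgD; apply: cvgM; [exact: cca|exact: cb|exact: ccb|exact: ca].
by move=> t; exact: is_deriveM.
Qed.

Lemma C1_real_comp a b : C1_real a -> C1_real b -> C1_real (a \o b).
Proof.
move=> [da [ca ada]] Cb; have ccb := C1_real_continuous Cb.
case: Cb => [db [cb bdb]].
exists (fun t => da (b t) * db t); split.
  move=> t; apply: cvgM; last exact: cb.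
  by apply: (@continuous_comp _ _ _ b da); [exact: ccb|exact: ca].
by move=> t; exact: is_derive1_comp.
Qed.

Lemma C1_real_expR : C1_real expR.
Proof.
by exists expR; split; [exact: continuous_expR|exact: is_derive_expR].
Qed.

(** Squaring the positive part makes it continuously differentiable, which is all the regularity
    that test fields require; every cutoff is built from it. *)
Definition pos_sqr t : R := Num.max 0 t ^+ 2.

Lemma pos_sqr_gt0 t : 0 < t -> pos_sqr t = t ^+ 2.
Proof. by move=> t0; rewrite /pos_sqr max_r// ltW. Qed.

Lemma pos_sqr_le0 t : t <= 0 -> pos_sqr t = 0.
Proof. by move=> t0; rewrite /pos_sqr max_l// expr0n. Qed.

Lemma pos_sqr_ge0 t : 0 <= pos_sqr t.
Proof. exact: sqr_ge0. Qed.

Lemma C1_pos_sqr : C1_real pos_sqr.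
Proof.
have cm : continuous (fun t : R => Num.max 0 t).
  move=> t; apply: (@continuous_max _ _ (fun=> 0) id) => //; exact: cvg_cst.
exists (fun t => Num.max 0 t *+ 2); split.
  by move=> t; rewrite /continuous_at; apply: cvgMn; exact: cm.
move=> t; have [t0|t0|->] := ltgtP t 0.
- rewrite mul0rn; apply: (near_eq_is_derive (f := cst 0)).
  have : \forall s \near t, s < 0 by exact: lt_nbhsl.
  by apply: filterS => s s0; rewrite pos_sqr_le0// ltW.
- apply: (near_eq_is_derive (f := (fun s : R => s * s : R))).
    have : \forall s \near t, 0 < s by exact: lt_nbhsr.
    by apply: filterS => s s0; rewrite pos_sqr_gt0// expr2.
  have := is_deriveM (is_derive_id t (1 : R)) (is_derive_id t (1 : R)).
  move=> dss; apply: (is_derive_eq (f := fun s : R => s * s : R) dss).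
  by rewrite /GRing.scale/= mulr1 mulr2n.
(* At the origin the Caratheodory slope function is the positive part:
   [pos_sqr s = max(0, s) * s]. *)
- rewrite ?maxxx mul0rn; apply/is_derive1_caratheodory.
  exists (fun s => Num.max 0 s); split; [|exact: cm|by rewrite maxxx].
  move=> s; rewrite (pos_sqr_le0 (lexx 0)) !subr0.
  have [s0|s0] := leP s 0; first by rewrite pos_sqr_le0// mul0r.
  by rewrite pos_sqr_gt0// expr2.
Qed.

(** The base point [1/2] keeps the integration inside the positive half-line. It is low enough for
    later use: coordinates there exceed 1 and are moved by at most [1/2]. *)
Lemma primitive_exists (f : R -> R) : (forall t, 0 < t -> {for t, continuous f}) ->
  exists J : R -> R, forall t, 2^-1 < t -> is_derive t (1 : R) J (f t).
Proof.
move=> cf.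
pose J (y : R) : R := (\int[@lebesgue_measure R]_(s in `[2^-1, y]) f s)%R.
exists J => t t2.
have [dJ JE] : derivable J t 1 /\ derive1 J t = f t.
  apply: (@continuous_FTC1_closed _ f 2^-1 t (t + 1)) => //.
  - by rewrite ltrDl.
  - apply: continuous_compact_integrable; first exact: segment_compact.
    apply: continuous_in_subspaceT => s /set_mem /=; rewrite in_itv/= => /andP[s2 _].
    by apply: cf; apply: lt_le_trans s2; rewrite invr_gt0.
  - by apply: cf; apply: lt_trans t2; rewrite invr_gt0.
by apply: DeriveDef dJ _; rewrite -derive1E.
Qed.

End C1_real.

Section C1_on_calculus.
Context {R : realType} {d : nat}.
Implicit Types (V : set 'rV[R]_d) (g f : 'rV[R]_d -> R) (x : 'rV[R]_d) (i j k : 'I_d).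

Lemma C1_onI V g (dg : 'I_d -> 'rV[R]_d -> R) : open V ->
  (forall i x, V x -> is_derive x (delta_mx 0 i : 'rV[R]_d) g (dg i x)) ->
  (forall i x, V x -> {for x, continuous (dg i)}) -> C1_on V g.
Proof.
move=> oV gdg cdg i x Vx; have [dgx gE] := gdg i x Vx; split => //.
have E : \forall y \near x, dg i y = partial i g y.
  have nV : nbhs x V by exact: open_nbhs_nbhs.
  by apply: filterS nV => y Vy; have [_ <-] := gdg i y Vy.
rewrite /prop_for /continuous_at -(nbhs_singleton E).
apply: cvg_trans (cdg i x Vx); apply: (@near_eq_cvg _ _ (nbhs x) (nbhs_filter x)); exact: E.
Qed.

Lemma C1_on_derive V g i x : C1_on V g -> V x ->
  is_derive x (delta_mx 0 i : 'rV[R]_d) g (partial i g x).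
Proof. by move=> Cg Vx; have [dg _] := Cg i x Vx; exact: derivableP. Qed.

Lemma C1_on_cst V (c : R) : open V -> C1_on V (fun=> c).
Proof.
move=> oV; apply: (@C1_onI _ _ (fun _ _ => 0)) => // i x Vx; last exact: cst_continuous.
Qed.

Lemma C1_onD V f g : open V -> C1_on V f -> C1_on V g -> C1_on V (fun x => f x + g x).
Proof.
move=> oV Cf Cg; apply: (@C1_onI _ _ (fun i x => partial i f x + partial i g x)) => // i x Vx.
  by apply: is_deriveD; [exact: C1_on_derive Cf Vx|exact: C1_on_derive Cg Vx].
by apply: (@cvgD _ _ _ (nbhs x)); [case: (Cf i x Vx)|case: (Cg i x Vx)].
Qed.

Lemma C1_onM V f g : open V -> C1_on V f -> C1_on V g -> C1_on V (fun x => f x * g x).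
Proof.
move=> oV Cf Cg.
apply: (@C1_onI _ _ (fun i x => f x * partial i g x + g x * partial i f x)) => // i x Vx.
  by apply: is_deriveM; [exact: C1_on_derive Cf Vx|exact: C1_on_derive Cg Vx].
have cf := C1_continuous oV Cf Vx; have cg := C1_continuous oV Cg Vx.
by apply: (@cvgD _ _ _ (nbhs x)); apply: (@cvgM _ _ (nbhs x)) => //;
  [case: (Cg i x Vx)|case: (Cf i x Vx)].
Qed.

Lemma C1_on_prod V (P : pred 'I_d) (F : 'I_d -> 'rV[R]_d -> R) : open V ->
  (forall j, P j -> C1_on V (F j)) -> C1_on V (fun x => \prod_(j | P j) F j x).
Proof.
move=> oV CF; rewrite (_ : (fun x => _) = (fun x => (\big[*%R/1]_(j | P j) F j) x)).
  apply: (big_ind (C1_on V)); last exact: CF.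
    exact: (C1_on_cst (1 : R) oV).
  by move=> f g; exact: C1_onM.
by apply/funext => x; elim/big_rec2 : _ => // j y1 y2 _ ->.
Qed.

Lemma C1_on_coord V j (a da : R -> R) : open V ->
  (forall x, V x -> is_derive (x 0 j) (1 : R) a (da (x 0 j))) ->
  (forall x, V x -> {for x 0 j, continuous da}) -> C1_on V (fun x => a (x 0 j)).
Proof.
move=> oV ada cda.
apply: (@C1_onI _ _ (fun k x => if j == k then da (x 0 j) else 0)) => // k x Vx.
  by apply: is_derive_coord; exact: ada.
case: eqVneq => _; last exact: cst_continuous.
apply: (@continuous_comp _ _ _ (fun y : 'rV[R]_d => y 0 j) da); first exact: coord_continuous.
exact: cda.
Qed.

Lemma is_derive_shift_rV g x (u v : 'rV[R]_d) (l : R) :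
  is_derive (x + u) v g l -> is_derive x v (fun y => g (y + u)) l.
Proof.
have E : (fun h : R => h^-1 *: (((fun y => g (y + u)) \o shift x) (h *: v) - g (x + u)))
  = (fun h : R => h^-1 *: ((g \o shift (x + u)) (h *: v) - g (x + u))).
  by apply/funext => h /=; rewrite /shift addrA.
have dE : 'D_v (fun y => g (y + u)) x = 'D_v g (x + u) by rewrite /derive E.
have dP : derivable (fun y => g (y + u)) x v = derivable g (x + u) v by rewrite /derivable E.
by move=> [dg <-]; apply: DeriveDef; [rewrite dP|rewrite dE].
Qed.

Lemma C1_on_shift V V' g (u : 'rV[R]_d) : open V -> C1_on V' g ->
  (forall x, V x -> V' (x + u)) -> C1_on V (fun x => g (x + u)).
Proof.
move=> oV Cg VV'.
apply: (@C1_onI _ _ (fun i x => partial i g (x + u))) => // i x Vx.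
  by apply: is_derive_shift_rV; apply: C1_on_derive Cg _; exact: VV'.
have [_ cp] := Cg i _ (VV' x Vx).
apply: (@continuous_comp _ _ _ (fun y : 'rV[R]_d => y + u) (partial i g)) => //.
by apply: (@cvgD _ _ _ (nbhs x)); [exact: cvg_id|exact: cst_continuous].
Qed.

Lemma C1_onW V V' g : V `<=` V' -> C1_on V' g -> C1_on V g.
Proof. by move=> VV' Cg i x /VV'; exact: Cg. Qed.

End C1_on_calculus.

Section tensors.
Context {R : realType} {d : nat}.
Implicit Types (F G : 'rV[R]_d -> R) (x : 'rV[R]_d) (i j k : 'I_d).

(* On finite sums of products of one-variable functions, integration along one
   coordinate acts on a single factor. *)
Inductive tensor : ('rV[R]_d -> R) -> Prop :=
| tensor0 : tensor (fun=> 0)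
| tensor_cons c (a : 'I_d -> R -> R) F : (forall j, C1_real (a j)) -> tensor F ->
    tensor (fun x => c * \prod_j a j (x 0 j) + F x).

Lemma tensor_ext F G : F =1 G -> tensor F -> tensor G.
Proof. by move=> /funext ->. Qed.

Lemma tensor_term c (a : 'I_d -> R -> R) : (forall j, C1_real (a j)) ->
  tensor (fun x => c * \prod_j a j (x 0 j)).
Proof.
move=> Ca; apply: tensor_ext (tensor_cons c Ca tensor0) => x; exact: addr0.
Qed.

Lemma tensorD F G : tensor F -> tensor G -> tensor (fun x => F x + G x).
Proof.
elim=> [|c a F' Ca _ IH] tG; first by apply: tensor_ext tG => x; rewrite add0r.
by apply: tensor_ext (tensor_cons c Ca (IH tG)) => x; rewrite addrA.
Qed.

Lemma tensorM F G : tensor F -> tensor G -> tensor (fun x => F x * G x).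
Proof.
elim=> [|c a F' Ca _ IH] tG; first by apply: tensor_ext tensor0 => x; rewrite mul0r.
have : tensor (fun x => (c * \prod_j a j (x 0 j)) * G x).
  elim: tG => [|c' a' G' Ca' _ IH']; first by apply: tensor_ext tensor0 => x; rewrite mulr0.
  have Caa j : C1_real (fun t => a j t * a' j t) by exact: C1_realM.
  apply: tensor_ext (tensor_cons (c * c') Caa IH') => x.
  by rewrite big_split/=; ring.
by move=> /tensorD /(_ (IH tG)); apply: tensor_ext => x; rewrite mulrDl.
Qed.

Lemma tensor_cst c : tensor (fun=> c).
Proof.
apply: tensor_ext (@tensor_term c (fun _ _ => 1) (fun=> C1_real_cst 1)) => x.
by rewrite big1// mulr1.
Qed.

Lemma tensorB F G : tensor F -> tensor G -> tensor (fun x => F x - G x).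
Proof.
move=> tF tG; apply: tensor_ext (tensorD tF (tensorM (tensor_cst (-1)) tG)) => x.
by rewrite mulN1r.
Qed.

Lemma tensor_prod (I : Type) (s : seq I) (P : pred I) (F : I -> 'rV[R]_d -> R) :
  (forall q, P q -> tensor (F q)) -> tensor (fun x => \prod_(q <- s | P q) F q x).
Proof.
move=> tF; elim: s => [|q s IH].
  by apply: tensor_ext (tensor_cst 1) => x; rewrite big_nil.
case/boolP : (P q) => Pq.
  by apply: tensor_ext (tensorM (tF q Pq) IH) => x; rewrite big_cons Pq.
by apply: tensor_ext IH => x; rewrite big_cons (negbTE Pq).
Qed.

Lemma tensor_coord j (a : R -> R) : C1_real a -> tensor (fun x => a (x 0 j)).
Proof.
move=> Ca.
have Cb k : C1_real (if k == j then a else fun=> 1).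
  by case: ifP => // _; exact: C1_real_cst.
apply: tensor_ext (@tensor_term 1 (fun k => if k == j then a else fun=> 1) Cb) => x.
by rewrite (bigD1 j)//= eqxx big1 ?mulr1 ?mul1r// => k /negbTE ->.
Qed.

Lemma measurable_tensor F : tensor F -> measurable_fun setT F.
Proof.
elim=> [|c a F' Ca _ IH]; first exact: measurable_cst.
apply: measurable_funD => //; apply: measurable_funM => //.
apply: measurable_prod => j _.
have ma : measurable_fun setT (a j).
  by apply: continuous_measurable_fun; exact: C1_real_continuous.
by apply: (measurableT_comp ma); exact: measurable_rV_coord.
Qed.

Lemma open_coord_gt i (c : R) : open [set x : 'rV[R]_d | c < x 0 i].
Proof.
apply: (@open_comp _ _ (fun x : 'rV[R]_d => x 0 i) [set t | c < t]) => //.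
by move=> x _; exact: coord_continuous.
Qed.

(** In each product only the factor in coordinate [i], multiplied by [w], is replaced by its
    primitive [J]; the remaining factors [N] are constant along [e_i]. *)
Lemma tensor_primitive i F (w : R -> R) : (forall t, 0 < t -> {for t, continuous w}) ->
  tensor F -> exists2 Phi : 'rV[R]_d -> R, C1_on [set y : 'rV[R]_d | 2^-1 < y 0 i] Phi &
    forall y : 'rV[R]_d, 2^-1 < y 0 i ->
      is_derive y (delta_mx 0 i : 'rV[R]_d) Phi (w (y 0 i) * F y).
Proof.
move=> cw; have oV := @open_coord_gt i 2^-1.
elim=> [|c a F' Ca _ [Phi CPhi dPhi]].
  exists (fun=> 0); first exact: C1_on_cst.
  by move=> y _; rewrite mulr0; exact: is_derive_cst.
have caw t : 0 < t -> {for t, continuous (fun t => a i t * w t)}.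
  by move=> t0; apply: cvgM; [exact: C1_real_continuous|exact: cw].
have [J HJ] := primitive_exists caw.
pose N (y : 'rV[R]_d) := \prod_(j | j != i) a j (y 0 j).
have CN : C1_on [set y : 'rV[R]_d | 2^-1 < y 0 i] N.
  apply: C1_on_prod => // j _; have [da [cda ada]] := Ca j.
  by apply: (@C1_on_coord _ _ _ _ (a j) da) => // x _; exact: cda.
have CJ : C1_on [set y : 'rV[R]_d | 2^-1 < y 0 i] (fun y => J (y 0 i)).
  apply: (@C1_on_coord _ _ _ _ J (fun t => a i t * w t)) => // x /= xi.
  by apply: caw; apply: lt_trans xi; rewrite invr_gt0.
exists (fun y : 'rV[R]_d => c * (J (y 0 i) * N y) + Phi y).
  exact: C1_onD oV (C1_onM oV (C1_on_cst c oV) (C1_onM oV CJ CN)) CPhi.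
move=> y yi.
have dJ := @is_derive_coord R d J y i i _ (HJ _ yi).
have dN : is_derive y (delta_mx 0 i : 'rV[R]_d) N 0.
  have /(_ y (delta_mx 0 i) 0 0) := @is_derive_line R _ N.
  rewrite scale0r addr0 => H; apply/H => {H}.
  rewrite (_ : (fun s => _) = fun=> N y); first exact: is_derive_cst.
  apply/funext => s; apply: eq_bigr => j ji.
  by rewrite !mxE eqxx/= (negbTE ji) mulr0 addr0.
have dc := is_derive_cst c y (delta_mx 0 i : 'rV[R]_d).
have := is_deriveD (is_deriveM dc (is_deriveM dJ dN)) (dPhi y yi).
move/is_derive_eq; apply; rewrite eqxx /GRing.scale/= (bigD1 i)//= /N; ring.
Qed.

End tensors.

(** * Approximation of indicators by tensors in a weighted [L^1] norm *)

Section tensor_density.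
Context {R : realType} {d : nat}.
Implicit Types (F G H eta : 'rV[R]_d -> R) (x : 'rV[R]_d) (i j k : 'I_d) (A : set 'rV[R]_d).
Local Notation lam := (lebesgue_rV d : {sigma_finite_measure set 'rV[R]_d -> \bar R}).
Variable q : 'rV[R]_d -> R.
Hypotheses (q0 : forall x, 0 <= q x) (iq : lam.-integrable setT (EFin \o q)).

Let mq : measurable_fun setT q.
Proof. by apply/measurable_EFinP; case/integrableP: iq. Qed.

Definition unit_valued G := forall x, 0 <= G x <= 1.

Definition L1_dist G H : \bar R := (\int[lam]_x (`|G x - H x| * q x)%:E)%E.

(** Approximants are kept between 0 and 1 so that [2 * eta - 1], the substitute for a sign, is
    bounded by 1. *)
Definition tensor_approximable G : Prop := forall e : R, 0 < e -> exists eta,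
  [/\ tensor eta, unit_valued eta & (L1_dist G eta <= e%:E)%E].

Let mdist G H : measurable_fun setT G -> measurable_fun setT H ->
  measurable_fun setT (fun x => (`|G x - H x| * q x)%:E).
Proof.
move=> mG mH; apply/measurable_EFinP; apply: measurable_funM => //.
by apply: measurableT_comp => //; exact: measurable_funB.
Qed.

Lemma L1_dist_le G1 G2 H1 H2 G H :
  measurable_fun setT G1 -> measurable_fun setT G2 ->
  measurable_fun setT H1 -> measurable_fun setT H2 ->
  measurable_fun setT G -> measurable_fun setT H ->
  (forall x, `|G x - H x| <= `|G1 x - H1 x| + `|G2 x - H2 x|) ->
  (L1_dist G H <= L1_dist G1 H1 + L1_dist G2 H2)%E.
Proof.
move=> mG1 mG2 mH1 mH2 mG mH le.
rewrite /L1_dist -ge0_integralD//; last 4 first.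
- by move=> x _; rewrite lee_fin mulr_ge0.
- exact: mdist.
- by move=> x _; rewrite lee_fin mulr_ge0.
- exact: mdist.
apply: ge0_le_integral => //.
- by move=> x _; rewrite lee_fin mulr_ge0.
- exact: mdist.
- by apply: emeasurable_funD; exact: mdist.
- by move=> x _; rewrite -EFinD lee_fin -mulrDl ler_wpM2r.
Qed.

Lemma tensor_approximable_tensor eta : tensor eta -> unit_valued eta ->
  tensor_approximable eta.
Proof.
move=> teta eta1 e e0; exists eta; split => //.
by rewrite /L1_dist integral0_eq ?lee_fin ?ltW// => x _; rewrite subrr normr0 mul0r.
Qed.

(** Functions with values in [[0, 1]] differ by at most 1, so [q] itself is the dominating
    function. *)
Lemma tensor_approximable_lim (G : nat -> 'rV[R]_d -> R) (H : 'rV[R]_d -> R) :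
  (forall n, measurable_fun setT (G n)) -> measurable_fun setT H ->
  (forall n, unit_valued (G n)) -> unit_valued H ->
  (forall x, G n x @[n --> \oo] --> H x) ->
  (forall n, tensor_approximable (G n)) -> tensor_approximable H.
Proof.
move=> mG mH G1 H1 GH aG e e0.
have cv : ((\int[lam]_x (`|H x - G n x| * q x)%:E)%E @[n --> \oo] -->
           (\int[lam]_x (cst 0%E x))%E).
  apply: (@dominated_cvg _ _ _ lam setT measurableT
    (fun n x => (`|H x - G n x| * q x)%:E) (cst 0%E) (EFin \o q)) => //.
  - by move=> n; exact: mdist.
  - move=> x _; apply: cvg_EFin; first exact: nearW.
    rewrite -[X in _ --> X](mul0r (q x)); apply: cvgMl.
    rewrite -[X in _ --> X](@normr0 R R) -(subrr (H x)); apply: cvg_norm.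
    by apply: cvgB; [exact: cvg_cst|exact: GH].
  - move=> n x _; rewrite lee_fin ger0_norm ?mulr_ge0// ler_piMl//.
    have /andP[] := H1 x; have /andP[] := G1 n x => *; rewrite ler_norml; lra.
rewrite integral0 in cv.
have [N _ HN] : \forall n \near \oo, (L1_dist H (G n) <= (e / 2)%:E)%E.
  have e2 : (0 < (e / 2)%:E :> \bar R)%E by rewrite lte_fin divr_gt0.
  move/fine_cvgP : cv => [cfin /cvgrPdist_lt /(_ _ (divr_gt0 e0 (ltr0Sn R 1)))].
  apply: filterS2 cfin => n; rewrite /= sub0r normrN => fn ltn.
  by rewrite /L1_dist -(fineK fn) lee_fin ltW// (le_lt_trans (ler_norm _)).
have [eta [teta eta1 etaN]] := aG N (e / 2) (divr_gt0 e0 (ltr0Sn R 1)).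
exists eta; split => //.
rewrite (_ : e = e / 2 + e / 2); last by field.
rewrite EFinD; apply: le_trans (leeD (HN N (leqnn N)) etaN).
apply: L1_dist_le => //; try exact: measurable_tensor.
by move=> x; rewrite -[_ - _](subrKA (G N x)); exact: ler_normD.
Qed.

Lemma tensor_approximableC A : tensor_approximable \1_A -> tensor_approximable \1_(~` A).
Proof.
move=> aA e e0; have [eta [teta eta1 etae]] := aA e e0.
exists (fun x => 1 - eta x); split.
- by apply: tensorB => //; exact: tensor_cst.
- by move=> x; have /andP[] := eta1 x; lra.
- apply: le_trans etae; rewrite le_eqVlt; apply/orP; left; apply/eqP.
  apply: eq_integral => x _; rewrite !indicE in_setC; congr (_ * _)%:E.
  by case: (x \in A) => /=; rewrite ?sub0r ?normrN// subKr.
Qed.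

Lemma tensor_approximableU A A' : measurable A -> measurable A' ->
  tensor_approximable \1_A -> tensor_approximable \1_A' -> tensor_approximable \1_(A `|` A').
Proof.
move=> mA mA' aA aA' e e0; have e2 : 0 < e / 2 by rewrite divr_gt0.
have [f [tf f1 fe]] := aA _ e2; have [g [tg g1 ge]] := aA' _ e2.
(* This is [1 - (1 - f) * (1 - g)]: it stays between 0 and 1, and its error is at most the sum of
   the two errors. *)
exists (fun x => f x + g x - f x * g x); split.
- by apply: tensorB; [exact: tensorD|exact: tensorM].
- by move=> x; have /andP[] := f1 x; have /andP[] := g1 x; nra.
rewrite (_ : e = e / 2 + e / 2); last by field.
rewrite EFinD; apply: le_trans (leeD fe ge).
have mf := measurable_tensor tf; have mg := measurable_tensor tg.
apply: L1_dist_le => //.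
- by apply: measurable_indic; exact: measurableU.
- by apply: measurable_funB; [exact: measurable_funD|exact: measurable_funM].
move=> x; have /andP[f0 f1x] := f1 x; have /andP[g0 g1x] := g1 x.
rewrite !indicE in_setU.
case: (x \in A); case: (x \in A') => /=; rewrite ?sub0r ?normrN.
- rewrite (_ : _ - _ = (1 - f x) * (1 - g x)); last by rewrite /=; ring.
  rewrite !ger0_norm ?mulr_ge0 ?subr_ge0//; nra.
- rewrite (_ : _ - _ = (1 - f x) * (1 - g x)); last by rewrite /=; ring.
  rewrite !ger0_norm ?mulr_ge0 ?subr_ge0//; nra.
- rewrite (_ : _ - _ = (1 - f x) * (1 - g x)); last by rewrite /=; ring.
  rewrite !ger0_norm ?mulr_ge0 ?subr_ge0//; nra.
- rewrite !ger0_norm//; nra.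
Qed.

Lemma tensor_approximable_halfspace j (a : R) : tensor_approximable \1_[set x | a < x 0 j].
Proof.
(* As [n] grows, [1 - exp(- n * (t - a)_+^2)] tends to 0 for [t <= a] and to 1 for [t > a], while
   remaining continuously differentiable. *)
pose f n (t : R) : R := 1 - expR (- (n%:R * pos_sqr (t - a))).
have Cf n : C1_real (f n).
  apply: C1_realD; first exact: C1_real_cst.
  have C1 : C1_real (fun t : R => -1 * expR (- n%:R * pos_sqr (t - a))).
    apply: C1_realM; first exact: C1_real_cst.
    apply: (@C1_real_comp _ expR); first exact: C1_real_expR.
    apply: C1_realM; first exact: C1_real_cst.
    apply: (@C1_real_comp _ pos_sqr); first exact: C1_pos_sqr.
    by apply: C1_realD; [exact: C1_real_id|exact: C1_real_cst].
  rewrite (_ : (fun t => _) = (fun t : R => -1 * expR (- n%:R * pos_sqr (t - a))))//.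
  by apply/funext => t; rewrite mulN1r mulNr.
have f01 n t : 0 <= f n t <= 1.
  rewrite /f subr_ge0 gerBl expR_ge0 andbT -expR0 ler_expR oppr_le0.
  by rewrite mulr_ge0// pos_sqr_ge0.
have mH : measurable [set x : 'rV[R]_d | a < x 0 j].
  by apply: open_measurable_rV; exact: open_coord_gt.
apply: (@tensor_approximable_lim (fun n x => f n (x 0 j))).
- by move=> n; apply: measurable_tensor; exact: (tensor_coord j (Cf n)).
- exact: measurable_indic.
- by move=> n x; exact: f01.
- by move=> x; rewrite indicE; case: (_ \in _); rewrite ?ler01 ?lexx.
- move=> x; rewrite indicE /f; have [ax|ax] := ltP a (x 0 j); last first.
    rewrite memNset; last by rewrite /= ltNge ax.
    apply: cvg_near_cst; apply: nearW => n.
    by rewrite pos_sqr_le0 ?subr_le0// mulr0 oppr0 expR0 subrr.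
  rewrite mem_set//=.
  rewrite pos_sqr_gt0 ?subr_gt0//; set s := (x 0 j - a) ^+ 2.
  have s0 : 0 < s by rewrite exprn_gt0// subr_gt0.
  rewrite -[X in _ --> X]subr0; apply: cvgB; first exact: cvg_cst.
  have -> : (fun n : nat => expR (- (n%:R * s))) = (fun n => (expR (- s)) ^+ n).
    by apply/funext => n; rewrite -mulrN mulrC -expRM_natr.
  by apply: cvg_expr; rewrite ger0_norm ?expR_ge0// -expR0 ltr_expR oppr_lt0.
- move=> n; apply: tensor_approximable_tensor; last by move=> x; exact: f01.
  exact: (tensor_coord j (Cf n)).
Qed.

(** The measurable approximable sets form a sigma-algebra, countable unions being limits of finite
    ones, and it contains the coordinate half-spaces, which generate. *)
Lemma tensor_approximable_indic A : measurable A -> tensor_approximable \1_A.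
Proof.
pose Dn := [set A | measurable A /\ tensor_approximable \1_A].
have sD : sigma_algebra setT Dn.
  split.
  - split; first exact: measurable0.
    rewrite indic0; apply: tensor_approximable_tensor; first exact: tensor0.
    by move=> x; rewrite lexx ler01.
  - move=> B [mB aB]; rewrite setTD; split; first exact: measurableC.
    exact: tensor_approximableC.
  - move=> B HB; split; first by apply: bigcup_measurable => n _; case: (HB n).
    have HBn n : Dn (\big[setU/set0]_(k < n) B k).
      elim: n => [|n [m1 a1]].
        rewrite big_ord0; split; first exact: measurable0.
        rewrite indic0; apply: tensor_approximable_tensor; first exact: tensor0.
        by move=> x; rewrite lexx ler01.
      have [m2 a2] := HB n.
      by rewrite big_ord_recr/=; split; [exact: measurableU|exact: tensor_approximableU].
    have u01 (C : set 'rV[R]_d) : unit_valued \1_C.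
      by move=> x; rewrite indicE; case: (_ \in _); rewrite ?ler01 ?lexx.
    apply: (@tensor_approximable_lim (fun n => \1_(\big[setU/set0]_(k < n) B k))) => //.
    + by move=> n; apply: measurable_indic; case: (HBn n).
    + by apply: measurable_indic; apply: bigcup_measurable => n _; case: (HB n).
    + move=> x; have [[m _ Bm]|nx] := pselect ((\bigcup_n B n) x).
        apply: cvg_near_cst; near=> n.
        rewrite !indicE !mem_set//; first by exists m.
        rewrite -bigcup_mkord; exists m => //=; near: n; exact: nbhs_infty_gt.
      apply: cvg_near_cst; apply: nearW => n.
      rewrite !indicE !memNset// -bigcup_mkord => -[m _ Bm].
      by apply: nx; exists m.
    + by move=> n; case: (HBn n).
move=> mA; suff : Dn A by case.
move: A mA; apply: smallest_sub => // A.
rewrite -bigcup_seq => -[j _ [B mB <-]]; rewrite setTI.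
(* A second sigma-algebra argument, now on the line with the coordinate [j] fixed, reduces preimages
   of Borel sets to those of open rays. *)
move: B mB; pose E := [set B : set R | Dn (rV_coord j @^-1` B)].
have sE : sigma_algebra setT E.
  have [D0 DC DU] := sD; split.
  - by rewrite /E /= preimage_set0.
  - by move=> B EB; rewrite /E /= setTD preimage_setC -setTD; exact: DC.
  - by move=> B EB; rewrite /E /= preimage_bigcup; exact: DU.
have : @measurable _ (measurableTypeR R) `<=` E.
  rewrite (RGenOInfty.measurableE R); apply: smallest_sub => // _ [a ->].
  rewrite /E /= (_ : _ @^-1` _ = [set x : 'rV[R]_d | a < x 0 j]); last first.
    by apply/seteqP; split => x; rewrite /= in_itv/= andbT.
  split; first by apply: open_measurable_rV; exact: open_coord_gt.
  exact: tensor_approximable_halfspace.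
exact.
Unshelve. all: by end_near. Qed.

End tensor_density.

(** * Cutoff functions *)

Section cutoffs.
Context {R : realType} {d : nat} (U : set 'rV[R]_d).
Implicit Types (x : 'rV[R]_d) (i j k : 'I_d).
Hypothesis oU : open U.

Lemma prod_unit (I : Type) (s : seq I) (P : pred I) (F : I -> R) :
  (forall q, P q -> 0 <= F q <= 1) -> 0 <= \prod_(q <- s | P q) F q <= 1.
Proof.
move=> F01; rewrite prodr_ge0 => [/=|q Pq]; last by case/andP: (F01 q Pq).
by apply: le_trans (@ler_prod R I s P F (fun=> 1) F01) _; rewrite big1.
Qed.

(** The profile [(1 - s^2)_+^2] in the variable [s = (t - c) / r]. *)
Definition bump (c r t : R) : R := pos_sqr (1 - ((t - c) / r) ^+ 2).

Lemma C1_bump c r : C1_real (bump c r).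
Proof.
apply: (@C1_real_comp _ pos_sqr); first exact: C1_pos_sqr.
have Cl : C1_real (fun t : R => (t - c) * r^-1).
  apply: C1_realM; last exact: C1_real_cst.
  by apply: C1_realD; [exact: C1_real_id|exact: C1_real_cst].
rewrite (_ : (fun t => _) = fun t : R => 1 + (-1) * (((t - c) * r^-1) * ((t - c) * r^-1))).
  apply: C1_realD; first exact: C1_real_cst.
  by apply: C1_realM; [exact: C1_real_cst|exact: C1_realM].
by apply/funext => t; rewrite mulN1r expr2.
Qed.

Lemma bump_unit c r t : 0 <= bump c r t <= 1.
Proof.
rewrite pos_sqr_ge0/= /bump; set s := _ ^+ 2.
have s0 : 0 <= s by exact: sqr_ge0.
have [h|h] := leP (1 - s) 0; first by rewrite pos_sqr_le0.
by rewrite pos_sqr_gt0// expr_le1//; lra.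
Qed.

Lemma bump_support c r t : 0 < r -> bump c r t != 0 -> `|t - c| <= r.
Proof.
move=> r0; apply: contra_neqT; rewrite -ltNge => rt; apply: pos_sqr_le0.
rewrite subr_le0 -real_normK ?num_real// expr_ge1// normrM normfV (gtr0_norm r0).
by rewrite ler_pdivlMr// mul1r ltW.
Qed.

(** Within [r / 2] of the centre the value is at least [(1 - 1/4)^2 = 9/16]; the rounder [1/4] is
    the source of the factor [4 ^+ d]. *)
Lemma bump_inner c r t : 0 < r -> `|t - c| < r / 2 -> 4^-1 <= bump c r t.
Proof.
move=> r0 tr; have h : `|(t - c) / r| <= 2^-1.
  by rewrite normrM normfV (gtr0_norm r0) ler_pdivrMr// mulrC ltW.
have : ((t - c) / r) ^+ 2 <= 4^-1.
  rewrite -real_normK ?num_real//; have := normr_ge0 ((t - c) / r).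
  move: h; set s := `|_| => h s0; rewrite expr2; nra.
rewrite /bump; set s := _ ^+ 2 => s4; rewrite pos_sqr_gt0; last by lra.
rewrite expr2; nra.
Qed.

Local Notation ctr q := (@rational_cube R d q).1.
Local Notation rad q := (@rational_cube R d q).2.

Definition cube_bump q x : R := \prod_j bump (ctr q 0 j) (rad q) (x 0 j).

Lemma tensor_cube_bump q : tensor (cube_bump q).
Proof.
apply: tensor_prod => j _; exact: (tensor_coord j (C1_bump _ _)).
Qed.

Lemma cube_bump_unit q x : 0 <= cube_bump q x <= 1.
Proof.
by apply: prod_unit => j _; exact: bump_unit.
Qed.

Lemma cube_bump_support q x : 0 < rad q -> cube_bump q x != 0 ->
  forall j, `|x 0 j - ctr q 0 j| <= rad q.
Proof.
move=> r0 /prodf_neq0 bx j; apply: bump_support => //; exact: bx.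
Qed.

Lemma cube_bump_inner q x : 0 < rad q -> inner_cube q x -> 1 <= 4 ^+ d * cube_bump q x.
Proof.
move=> r0 qx; rewrite -[X in 4 ^+ X]card_ord -prodr_const -big_split/=.
have h j : true -> 0 <= (1 : R) <= 4 * bump (ctr q 0 j) (rad q) (x 0 j).
  by move=> _; have := bump_inner r0 (qx j); lra.
by apply: le_trans (@ler_prod R _ _ _ (fun=> 1) _ h); rewrite big1.
Qed.

(** A union of bumps: unlike their sum, [1 - prod (1 - bump)] stays between 0 and 1, and it is still
    a tensor. *)
Definition cutoff n x : R := 1 - \prod_(q < n | `[< good_cube U q >]) (1 - cube_bump q x).

(** The radii keep translates of the cutoff inside the outer cubes; the term [1 / (n + 2)] forces
    convergence to 0 and the bound [1/2], under which the primitives are available. *)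
Definition cutoff_step n : R :=
  \big[Num.min/(n.+2%:R)^-1]_(q < n | `[< good_cube U q >]) rad q.

Definition cutoff_hull n : set 'rV[R]_d :=
  \big[setU/set0]_(q < n | `[< good_cube U q >]) outer_cube q.

Lemma tensor_cutoff n : tensor (cutoff n).
Proof.
apply: tensorB; first exact: tensor_cst.
apply: tensor_prod => q _; apply: tensorB; [exact: tensor_cst|exact: tensor_cube_bump].
Qed.

Lemma cutoff_unit n : unit_valued (cutoff n).
Proof.
move=> x; have b01 q : 0 <= 1 - cube_bump q x <= 1.
  by have /andP[] := cube_bump_unit q x; lra.
rewrite /cutoff; set P := \prod_(_ < _ | _) _.
have : 0 <= P <= 1 by exact: prod_unit.
by move=> /andP[]; lra.
Qed.

Lemma cutoff_step_gt0 n : 0 < cutoff_step n.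
Proof.
by apply/bigmin_gtP; split=> [|q /asboolP[]//]; rewrite invr_gt0 ltr0n.
Qed.

Lemma cutoff_step_le n : cutoff_step n <= (n.+2%:R)^-1.
Proof. exact: bigmin_le_id. Qed.

Lemma cutoff_step_cvg0 : cutoff_step n @[n --> \oo] --> (0 : R).
Proof.
apply: (@squeeze_cvgr _ _ _ _ (fun=> 0) harmonic); last 2 first.
- exact: cvg_cst.
- exact: cvg_harmonic.
near=> n; rewrite ltW ?cutoff_step_gt0//= (le_trans (cutoff_step_le n))//.
by rewrite lef_pV2 ?posrE ?ltr0n// ler_nat.
Unshelve. all: by end_near. Qed.

Lemma compact_outer_cube q : compact (outer_cube q : set 'rV[R]_d).
Proof.
rewrite (_ : outer_cube q = [set v : 'rV[R]_d | forall j,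
    `[ctr q 0 j - rad q * 2, ctr q 0 j + rad q * 2]%classic (v ord0 j)]).
  apply: (@rV_compact _ _ (fun j => `[ctr q 0 j - rad q * 2, ctr q 0 j + rad q * 2]%classic)) => j.
  exact: segment_compact.
apply/seteqP; split => x H j; have := H j; rewrite /= in_itv/= ler_norml; lra.
Qed.

Lemma compact_cutoff_hull n : compact (cutoff_hull n).
Proof. by apply: bigsetU_compact => q _; exact: compact_outer_cube. Qed.

Lemma cutoff_hull_sub n : cutoff_hull n `<=` U.
Proof. by rewrite /cutoff_hull -bigcup_seq_cond => x [q /= /andP[_ /asboolP[_]]]; exact. Qed.

(** A nonzero cutoff makes one bump nonzero, which places [x] within [rad q] of a centre; a
    displacement of at most [rad q] then stays in the outer cube. *)
Lemma cutoff_support n x i s : cutoff n x != 0 -> `|s| <= cutoff_step n ->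
  cutoff_hull n (x + s *: delta_mx 0 i).
Proof.
move=> cx sn.
have [q gq bq] : exists2 q : 'I_n, `[< good_cube U q >] & cube_bump q x != 0.
  apply: contrapT => H; move: cx; rewrite /cutoff big1 ?subrr ?eqxx// => q gq.
  have [->|bq] := eqVneq (cube_bump q x) 0; first by rewrite subr0.
  by exfalso; apply: H; exists q.
rewrite /cutoff_hull -bigcup_seq_cond; exists q; first by rewrite /= mem_index_enum.
move/asboolP : gq => [r0 qU].
move=> j; have := cube_bump_support r0 bq j.
have sr : `|s| <= rad q by apply: le_trans sn _; apply: bigmin_le_cond; apply/asboolP.
rewrite !mxE eqxx/= => h.
have : `|s * (j == i)%:R| <= rad q.
  by case: (j == i); rewrite ?mulr1 ?mulr0 ?normr0// ltW.
rewrite addrAC => h'; apply: le_trans (ler_normD _ _) _; lra.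
Qed.

(** Each point of [A] lies in some good inner cube, and the cutoff is large on that cube as soon as
    its index is below [n]; compactness makes [n] uniform. *)
Lemma cutoff_cover A : compact A -> A `<=` U ->
  \forall n \near \oo, forall x, A x -> 1 <= 4 ^+ d * cutoff n x.
Proof.
move=> /compact_near_coveringP cA AU.
apply: (cA nat \oo (fun n x => 1 <= 4 ^+ d * cutoff n x)).
move=> x Ax; have [q gq qx] := good_cube_cover oU (AU x Ax).
exists ([set y | inner_cube q y], [set n | (q < n)%N]).
  split => /=; last exact: nbhs_infty_gt.
  pose e (j : 'I_d) : R := rad q / 2 - `|x 0 j - ctr q 0 j|.
  apply/nbhs_rVP; exists (\big[Num.min/1]_j e j).
    by apply/bigmin_gtP; split => // j _; rewrite subr_gt0; exact: qx.
  move=> y yx j; have := lt_le_trans (yx j) (bigmin_le 1 j e).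
  rewrite /e ltrBrDr => h; rewrite -(subrKA (x 0 j)); apply: le_lt_trans h; exact: ler_normD.
move=> [y n] [/= qy qn].
have [r0 _] := gq.
apply: le_trans (cube_bump_inner r0 qy) _; rewrite ler_wpM2l ?exprn_ge0//.
rewrite /cutoff (bigD1 (Ordinal qn))/=; last exact/asboolP.
(* The product over the other cubes is at most 1, so [1 - (1 - b) * P >= b] for the bump value [b]
   of the chosen cube. *)
set P := \prod_(_ | _) _.
have P1 : 0 <= P <= 1.
  by apply: prod_unit => m _; have /andP[] := cube_bump_unit m y; lra.
have /andP[b0 b1] := cube_bump_unit q y; nra.
Qed.

End cutoffs.

(** * Difference quotients are bounded by the variation *)

Section weight_ratio.
Context {R : realType}.

(** For [t] and [t + s] at least 1 with [|s| <= 1], each is at most twice the other, so the power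
    changes by a factor of at most [2^|b|], and the exponential by at most [e]. *)
Definition ratio_bound (b : R) : R := expR (1 + `|b| * ln 2).

Lemma ratio_bound_gt0 b : 0 < ratio_bound b. Proof. exact: expR_gt0. Qed.

Lemma exp_weight_ratio (b t s : R) : 1 <= t -> 1 <= t + s -> `|s| <= 1 ->
  exp_weight b (t + s) <= ratio_bound b * exp_weight b t.
Proof.
move=> t1 ts1; rewrite ler_norml => /andP[s1 s2].
rewrite /ratio_bound /exp_weight -expRD ler_expR.
have ln_le (u v : R) : 1 <= u -> 1 <= v -> v <= 2 * u -> ln v <= ln 2 + ln u.
  by move=> u1 v1 vu; rewrite -lnM ?posrE ?ler_ln ?posrE//; lra.
have h1 : ln (t + s) <= ln 2 + ln t by apply: ln_le => //; lra.
have h2 : ln t <= ln 2 + ln (t + s) by apply: ln_le => //; lra.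
have : `|b * (ln (t + s) - ln t)| <= `|b| * ln 2.
  by rewrite normrM ler_wpM2l// ler_norml; apply/andP; split; lra.
by move=> /(le_trans (ler_norm _)); lra.
Qed.

Lemma exp_weight_continuous (b t : R) : 0 < t -> {for t, continuous (exp_weight b)}.
Proof.
move=> t0; apply/differentiable_continuous/derivable1_diffP.
by case: (is_derive_exp_weight b t0).
Qed.

End weight_ratio.

(** * The test field obtained by integrating along one coordinate *)

Section directional_flux.
Context {R : realType} {d : nat} (alpha : 'rV[R]_d) (U : set 'rV[R]_d) (i : 'I_d).
Implicit Types (x y : 'rV[R]_d) (j k : 'I_d).
Hypotheses (oU : open U) (U1 : forall x, U x -> forall i, 1 < x 0 i).
Hypothesis c0 : 0 < laguerre_const alpha.
Local Notation lam := (lebesgue_rV d : {sigma_finite_measure set 'rV[R]_d -> \bar R}).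
Local Notation mu := (laguerre_measure alpha).
Let v : 'rV[R]_d := delta_mx 0 i.
Let b : R := alpha 0 i + 2^-1.
Let C : R := ratio_bound b.
Local Notation W := (flux_weight alpha i).

Let C1_inv_weight : C1_on U (fun y : 'rV[R]_d => (exp_weight b (y 0 i))^-1).
Proof.
apply: (@C1_on_coord _ _ _ i (fun t => (exp_weight b t)^-1)
  (fun t => - (b / t - 1) * (exp_weight b t)^-1)) => // x Ux.
  have x0 : 0 < x 0 i by exact: (subset_pos_orthant U1 Ux).
  have w0 : exp_weight b (x 0 i) != 0 by rewrite gt_eqF// exp_weight_gt0.
  have := is_deriveV w0 (is_derive_exp_weight b x0).
  move/is_derive_eq; apply; rewrite /GRing.scale/=; field.
  by rewrite w0 gt_eqF.
have x0 : 0 < x 0 i by exact: (subset_pos_orthant U1 Ux).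
apply: cvgM.
  apply: cvgN; apply: cvgB; last exact: cvg_cst.
  apply: cvgM; first exact: cvg_cst.
  by apply: cvgV; [rewrite gt_eqF|exact: cvg_id].
by apply: cvgV; [rewrite gt_eqF// exp_weight_gt0|exact: exp_weight_continuous].
Qed.

Variables (F Phi : 'rV[R]_d -> R) (h : R) (K : set 'rV[R]_d).
Hypotheses (h0 : 0 < h) (h2 : h <= 2^-1).
Hypotheses (cK : compact K) (KU : K `<=` U).
Hypothesis FK : forall x s, F x != 0 -> `|s| <= h -> K (x + s *: v).
Hypothesis F1 : forall x, `|F x| <= 1.
Hypothesis CPhi : C1_on [set y : 'rV[R]_d | 2^-1 < y 0 i] Phi.
Hypothesis dPhi : forall y : 'rV[R]_d, 2^-1 < y 0 i ->
  is_derive y v Phi (exp_weight b (y 0 i) * F y).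

Let Dif y : R := Phi y - Phi (y + (- h) *: v).

Let coordv y s : (y + s *: v) 0 i = y 0 i + s.
Proof. by rewrite !mxE !eqxx mulr1. Qed.

Let half y s : U y -> `|s| <= h -> 2^-1 < (y + s *: v) 0 i.
Proof.
move=> Uy; rewrite coordv ler_norml => /andP[s1 _].
by have := U1 Uy i; have := h2; lra.
Qed.

Let Dif_bound y (M : R) : U y ->
  (forall s, `|s| <= h -> `|exp_weight b ((y + s *: v) 0 i) * F (y + s *: v)| <= M) ->
  `|Dif y| <= M * h.
Proof.
move=> Uy HM; have := @rV_segment_bound R d Phi y v (- h) M.
rewrite normrN (gtr0_norm h0) distrC; apply => s sh.
  by case: (dPhi (half Uy sh)).
by rewrite (@derive_val _ _ _ _ _ _ _ (dPhi (half Uy sh))); exact: HM.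
Qed.

Let F_U x : F x != 0 -> U x.
Proof.
move=> Fx; apply: KU; have := @FK x 0 Fx; rewrite scale0r addr0; apply.
by rewrite normr0 ltW.
Qed.

Let Dif_le y : U y -> `|Dif y| <= C * exp_weight b (y 0 i) * h.
Proof.
move=> Uy; apply: Dif_bound => // s sh.
(* Where [F] is nonzero the translated point belongs to [U], so its coordinate exceeds 1 and the
   weights are comparable; elsewhere the derivative of [Phi] vanishes. *)
have [->|Fs] := eqVneq (F (y + s *: v)) 0.
  rewrite mulr0 normr0; apply: mulr_ge0; first exact: ltW (ratio_bound_gt0 b).
  exact: ltW (exp_weight_gt0 _ _).
rewrite normrM gtr0_norm ?exp_weight_gt0//.
apply: (@le_trans _ _ (exp_weight b ((y + s *: v) 0 i))).
  by rewrite ler_piMr// ltW// exp_weight_gt0.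
rewrite coordv; apply: exp_weight_ratio.
- exact/ltW/U1.
- by rewrite -coordv; exact/ltW/U1/F_U.
- by apply: le_trans sh _; have := h2; lra.
Qed.

(** If [F] were nonzero somewhere on the segment from [y - h v] to [y], moving back by at most [h]
    would put [y] in [K]. *)
Let Dif_off y : U y -> ~ K y -> Dif y = 0.
Proof.
move=> Uy Ky; apply/eqP; rewrite -normr_le0 -(mul0r h); apply: Dif_bound => // s sh.
rewrite normr_le0 mulf_eq0; apply/orP; right; apply/negPn/negP => Fs; apply: Ky.
have := @FK _ (- s) Fs; rewrite normrN => /(_ sh).
by rewrite scaleNr addrK.
Qed.

(** Normalises the field to size 1: by [Dif_le], [Dif] divided by the weight is at most [C * h]. *)
Let lambda : R := (C * h)^-1.

Let lambda_gt0 : 0 < lambda.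
Proof. by rewrite invr_gt0 mulr_gt0// ratio_bound_gt0. Qed.

(* [Dif y] is the integral of [exp_weight b * F] over the segment from [y - h v]
   to [y], so [rho] has the difference quotient of [phi] as flux divergence. *)
Let phi y : 'rV[R]_d := (lambda * (Dif y * (exp_weight b (y 0 i))^-1)) *: v.

Let phiE y j : phi y 0 j = if j == i then lambda * (Dif y * (exp_weight b (y 0 i))^-1) else 0.
Proof. by rewrite !mxE eqxx/=; case: ifP => _; rewrite ?mulr1 ?mulr0. Qed.

Let C1_Dif : C1_on U Dif.
Proof.
have CU : C1_on U Phi.
  by apply: C1_onW CPhi => y Uy /=; have := U1 Uy i; lra.
have CS : C1_on U (fun y => Phi (y + (- h) *: v)).
  apply: (C1_on_shift oU CPhi) => y Uy /=; apply: half => //.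
  by rewrite normrN gtr0_norm.
have := C1_onD oU CU (C1_onM oU (C1_on_cst (-1) oU) CS).
by congr C1_on; apply/funext => y; rewrite mulN1r.
Qed.

Let phi_test : test_fields U phi.
Proof.
split.
- move=> j; under eq_fun do rewrite phiE.
  case: (j == i); last exact: C1_on_cst.
  exact: C1_onM oU (C1_on_cst lambda oU) (C1_onM oU C1_Dif C1_inv_weight).
- have sub : closure [set x | U x /\ phi x != 0] `<=` K.
    have clK : closed K by apply: compact_closed cK; exact: norm_hausdorff.
    rewrite [X in _ `<=` X](closure_id K).1//; apply: closure_subset => y [Uy py].
    apply: contrapT => Ky; move: py; rewrite /phi Dif_off// mul0r mulr0 scale0r.
    by rewrite eqxx.
  split; last exact: subset_trans sub KU.
  by apply: (subclosed_compact _ cK sub); exact: closed_closure.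
- move=> y Uy; rewrite (bigD1 i)//= big1 ?addr0; last first.
    by move=> j /negbTE ji; rewrite phiE ji normr0 expr0n.
  rewrite sqrtr_sqr normr_id phiE eqxx !normrM (gtr0_norm lambda_gt0) normfV.
  rewrite (gtr0_norm (exp_weight_gt0 _ _)) /lambda mulrC ler_pdivrMr; last first.
    by rewrite mulr_gt0// ratio_bound_gt0.
  rewrite mul1r ler_pdivrMr ?exp_weight_gt0//; apply: le_trans (Dif_le Uy) _.
  by rewrite mulrAC.
Qed.

Let rho x : R := W x * F x.

Let dflux_phi j y : U y -> dflux alpha U phi j y =
  if j == i then lambda * (rho y - rho (y + (- h) *: v)) else 0.
Proof.
move=> Uy; case: eqVneq => [->|ji]; last first.
  rewrite /dflux patchE mem_set// /log_divergence phiE (negbTE ji) mulr0 addr0.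
  rewrite /partial (_ : (fun y => _) = cst 0) ?derive_cst ?mulr0//.
  by apply/funext => z; rewrite phiE (negbTE ji).
have dflx := is_derive_flux alpha oU U1 phi_test i y.
(* The one-variable weight in [flux_weight] cancels the inverse weight in [phi]; the remaining
   transverse weight is constant along [v], so the derivative falls on [Dif] alone. *)
pose G y := lambda * (transverse_weight alpha i y * Dif y).
have yU : nbhs y U by exact: open_nbhs_nbhs.
have eG : \forall z \near y, G z = flux alpha U phi i z.
  apply: filterS yU => z Uz; rewrite /flux patchE mem_set// phiE eqxx /flux_weight /G -/b.
  by field; rewrite gt_eqF// exp_weight_gt0.
have dT : is_derive y v (transverse_weight alpha i) 0.
  have /(_ y v 0 0) := @is_derive_line R _ (transverse_weight alpha i).
  rewrite scale0r addr0 => H; apply/H => {H}.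
  under eq_fun do rewrite transverse_weight_line.
  exact: is_derive_cst.
have hh : 2^-1 < (y + (- h) *: v) 0 i by apply: half => //; rewrite normrN gtr0_norm.
have y2 : 2^-1 < y 0 i by have := U1 Uy i; lra.
have dD : is_derive y v Dif (exp_weight b (y 0 i) * F y -
    exp_weight b ((y + (- h) *: v) 0 i) * F (y + (- h) *: v)).
  by apply: is_deriveB; [exact: dPhi|apply: is_derive_shift_rV; exact: dPhi].
have dG := is_deriveM (is_derive_cst lambda y v) (is_deriveM dT dD).
have dG' := near_eq_is_derive eG dG.
rewrite -(@derive_val _ _ _ _ _ _ _ dflx) (@derive_val _ _ _ _ _ _ _ dG').
rewrite /rho /flux_weight transverse_weight_line -/b /GRing.scale/=; ring.
Qed.

(** A translation moves the increment from [f] to [rho]. The increment of [rho] is [C * h] times the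
    flux divergence of the admissible field [phi], whose pairing with [f] is at most the
    variation. *)
Lemma primitive_flux_le (f : 'rV[R]_d -> R) : measurable_fun setT F ->
  mu.-integrable U (EFin \o f) ->
  (\int[lam]_x (rho x * ((f \_ U) (x + h *: v) - (f \_ U) x))%:E <=
     (C * h)%:E * laguerre_variation alpha U f)%E.
Proof.
move=> mF fi.
have mf : measurable_fun U f by apply/measurable_EFinP; case/integrableP: fi.
have [r Kr] := compact_cube cK.
have [M HM] := flux_weight_bound alpha i r.
have M0 : 0 <= Num.max 0 M by rewrite le_max lexx.
have mrho : measurable_fun setT rho by apply: measurable_funM => //; exact: measurable_flux_weight.
have rhoM x : `|rho x| <= Num.max 0 M.
  have [Fx|Fx] := eqVneq (F x) 0; first by rewrite /rho Fx mulr0 normr0.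
  have Kx : K x by have := @FK x 0 Fx; rewrite scale0r addr0 normr0; apply; exact: ltW.
  rewrite /rho normrM ger0_norm ?flux_weight_ge0//.
  apply: le_trans (ler_piMr (flux_weight_ge0 _ _ _) (F1 x)) _.
  by rewrite le_max HM ?orbT//; [move=> j; exact/ltW/U1/KU|exact: Kr].
have rho0 s x : `|s| <= h -> ~ cube d r x -> rho (x + s *: v) = 0.
  move=> sh; apply: contra_notP => rx; apply: Kr.
  have Fx : F (x + s *: v) != 0 by apply: contra_not_neq rx => Fx; rewrite /rho Fx mulr0.
  by have := @FK _ (- s) Fx; rewrite normrN scaleNr addrK; exact.
have irho s : `|s| <= h -> lam.-integrable setT (fun x => ((f \_ U) x * rho (x + s *: v))%:E).
  move=> sh; apply: (@integrable_patch_mul R d alpha U oU U1 f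
    (fun x => rho (x + s *: v)) r (Num.max 0 M) c0 fi).
  - exact: (measurableT_comp mrho (measurable_shift_rV (s *: v))).
  - by move=> x; exact: rhoM.
  - by move=> x; exact: rho0.
have hh : `|- h| <= h by rewrite normrN gtr0_norm.
have z0 : `|0 : R| <= h by rewrite normr0 ltW.
have main : (\int[lam]_x (rho x * ((f \_ U) (x + h *: v) - (f \_ U) x))%:E =
    (C * h)%:E * \int[lam]_x ((f \_ U) x * flux_divergence alpha U phi x)%:E)%E.
  transitivity (\int[lam]_x ((f \_ U) x * rho (x + (- h) *: v))%:E -
      \int[lam]_x ((f \_ U) x * rho (x + 0 *: v))%:E)%E.
    have := @integral_rV_shift R d (h *: v) (fun x => ((f \_ U) x * rho (x + (- h) *: v))%:E).
    move=> <-; last by case/integrableP: (irho _ hh).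
    have ih : lam.-integrable setT
        (fun x => ((f \_ U) (x + h *: v) * rho (x + h *: v + (- h) *: v))%:E).
      exact: (integrable_rV_shift (h *: v) (irho _ hh)).
    rewrite -integralB//; last exact: irho.
    apply: eq_integral => x _; rewrite -EFinB scale0r addr0 scaleNr addrK; congr EFin; ring.
  rewrite -integralB//; [|exact: irho..].
  rewrite -integralZl//; last first.
    exact: (integrable_patch_flux_divergence oU U1 phi_test c0 fi).
  apply: eq_integral => x _; rewrite -EFinB -EFinM; congr EFin.
  rewrite scale0r addr0 !patchE; case: ifPn => [/set_mem Ux|_]; last first.
    by rewrite !mul0r mulr0 subrr.
  rewrite /flux_divergence (bigD1 i)//= big1 ?addr0; last first.
    by move=> j /negbTE ji; rewrite dflux_phi// ji.
  rewrite dflux_phi// eqxx /lambda; field.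
  by rewrite !gt_eqF// ratio_bound_gt0.
rewrite main; apply: lee_wpmul2l; first by rewrite lee_fin mulr_ge0// ltW// ratio_bound_gt0.
apply: ereal_sup_ubound; exists phi => //.
by rewrite (integral_div_laguerre alpha oU U1 phi_test).
Qed.

End directional_flux.

Lemma limn_einf_le (R : realType) (u : (\bar R)^nat) (c : \bar R) :
  (forall n, u n <= c)%E -> (limn_einf u <= c)%E.
Proof.
move=> uc; rewrite limn_einf_lim; apply: lime_le; first exact: is_cvg_einfs.
apply: nearW => n; apply: le_trans (uc n).
by apply: ereal_inf_lbound; exists n => /=.
Qed.

(** * From difference quotients to perimeters *)

Section coarea.
Context {R : realType} {d : nat} (alpha : 'rV[R]_d) (U : set 'rV[R]_d).
Implicit Types (x y : 'rV[R]_d) (i j k : 'I_d).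
Hypotheses (oU : open U) (U1 : forall x, U x -> forall i, 1 < x 0 i).
Hypothesis c0 : 0 < laguerre_const alpha.
Local Notation lam := (lebesgue_rV d : {sigma_finite_measure set 'rV[R]_d -> \bar R}).
Local Notation mu := (laguerre_measure alpha).
Local Notation W := (flux_weight alpha).

Section fixed_function.
Variable f : 'rV[R]_d -> R.
Hypotheses (fi : mu.-integrable U (EFin \o f))
  (Vf : (laguerre_variation alpha U f < +oo)%E).

Let mf : measurable_fun U f.
Proof. by apply/measurable_EFinP; case/integrableP: fi. Qed.

Let ft := f \_ U.

Let mft : measurable_fun setT ft.
Proof. exact: measurable_patch. Qed.

Let mft_shift (u : 'rV[R]_d) : measurable_fun setT (fun x => ft (x + u)).
Proof. by apply: (measurableT_comp mft); exact: measurable_shift_rV. Qed.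

(** The inequality is shown up to any [e > 0]: [F] is the cutoff times a tensor close to the sign of
    the increment, [primitive_flux_le] bounds the resulting integral, and the remainder is at most
    [e]. *)
Lemma difference_quotient_le_variation n i :
  (\int[lam]_x (cutoff U n x * W i x *
      `|ft (x + cutoff_step U n *: delta_mx 0 i) - ft x|)%:E <=
   (ratio_bound (alpha 0 i + 2^-1) * cutoff_step U n)%:E * laguerre_variation alpha U f)%E.
Proof.
set h := cutoff_step U n; set v : 'rV[R]_d := delta_mx 0 i; set chi := cutoff U n.
have h0 : 0 < h by exact: cutoff_step_gt0.
have h2 : h <= 2^-1.
  apply: le_trans (cutoff_step_le U n) _.
  by rewrite lef_pV2 ?posrE ?ltr0n// ler_nat.
have tchi : tensor chi by exact: tensor_cutoff.
have mchi := measurable_tensor tchi.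
have chi1 x : 0 <= chi x <= 1 by exact: cutoff_unit.
have cK : compact (cutoff_hull U n) by exact: compact_cutoff_hull.
have KU := @cutoff_hull_sub R d U n.
have supp x s : chi x != 0 -> `|s| <= h -> cutoff_hull U n (x + s *: v).
  by move=> cx sh; exact: cutoff_support.
pose Delta x := ft (x + h *: v) - ft x.
have mDelta : measurable_fun setT Delta by exact: measurable_funB.
have mW := measurable_flux_weight alpha i.
have mcW : measurable_fun setT (fun x => chi x * W i x) by exact: measurable_funM.
have cW0 x : 0 <= chi x * W i x.
  by case/andP: (chi1 x) => c1 _; apply: mulr_ge0 => //; exact: flux_weight_ge0.
(* The integrand itself is the weight for the approximation, so the cost of replacing the sign is
   measured directly in the quantity to be bounded. *)
pose q x := chi x * W i x * `|Delta x|.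
have q0 x : 0 <= q x by exact: mulr_ge0.
have mq : measurable_fun setT q by apply: measurable_funM => //; exact: measurableT_comp.
have iq : lam.-integrable setT (EFin \o q).
  have [r Kr] := compact_cube cK.
  have [M HM] := flux_weight_bound alpha i r.
  have M0 : 0 <= Num.max 0 M by rewrite le_max lexx.
  have hh : `|- h| <= h by rewrite normrN gtr0_norm.
  have z0 : `|0 : R| <= h by rewrite normr0 ltW.
  have icW s : `|s| <= h -> lam.-integrable setT
      (fun x => (ft x * (chi (x + s *: v) * W i (x + s *: v)))%:E).
    move=> sh; apply: (@integrable_patch_mul R d alpha U oU U1 f
      (fun x => chi (x + s *: v) * W i (x + s *: v)) r (Num.max 0 M) c0 fi).
    - exact: (measurableT_comp mcW (measurable_shift_rV (s *: v))).
    - move=> x; set y := x + s *: v; rewrite ger0_norm//.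
      have [->|cy] := eqVneq (chi y) 0; first by rewrite mul0r.
      have Ky : cutoff_hull U n y by have := supp y 0 cy z0; rewrite scale0r addr0.
      apply: le_trans (ler_piMl (flux_weight_ge0 _ _ _) (proj2 (andP (chi1 y)))) _.
      by rewrite le_max HM ?orbT//; [move=> j; exact/ltW/U1/KU|exact: Kr].
    - move=> x; apply: contra_notP => rx; apply: Kr.
      have cy : chi (x + s *: v) != 0 by apply: contra_not_neq rx => ->; rewrite mul0r.
      by have := supp _ (- s) cy; rewrite normrN scaleNr addrK; exact.
  (* The translated part is integrable because it is the translate of [f] times a bounded function
     supported in a cube. *)
  have i1 := integrable_rV_shift (h *: v) (icW _ hh).
  have i2 := icW _ z0.
  have i12 := integrableB measurableT i1 i2.
  apply: (le_integrable measurableT _ _ i12); first exact/measurable_EFinP.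
  move=> x _ /=; rewrite lee_fin scale0r addr0 scaleNr addrK.
  rewrite (_ : _ - _ = (chi x * W i x) * Delta x); last by rewrite /Delta; ring.
  by rewrite /q !normrM normr_id.
have VfE : laguerre_variation alpha U f \is a fin_num.
  by rewrite ge0_fin_numE//; exact: laguerre_variation_ge0.
apply/lee_addgt0Pr => e e0.
pose P := [set x | 0 <= Delta x].
have mP : measurable P.
  rewrite (_ : P = Delta @^-1` `[0, +oo[).
    by rewrite -[X in measurable X]setTI; exact: mDelta.
  by apply/seteqP; split => x; rewrite /P /= in_itv/= andbT.
have [eta [teta eta1 etae]] :=
  tensor_approximable_indic q0 iq mP (divr_gt0 e0 (ltr0Sn R 1)).
have meta := measurable_tensor teta.
pose F x := chi x * (2 * eta x - 1).
have tF : tensor F.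
  apply: tensorM => //; apply: tensorB; last exact: tensor_cst.
  by apply: tensorM => //; exact: tensor_cst.
have mF := measurable_tensor tF.
have F1 x : `|F x| <= 1.
  rewrite normrM -[leRHS]mulr1; have /andP[c1 c2] := chi1 x; have /andP[e1 e2] := eta1 x.
  by apply: ler_pM => //; [rewrite ger0_norm|rewrite ler_norml; apply/andP; split; lra].
have FK x s : F x != 0 -> `|s| <= h -> cutoff_hull U n (x + s *: v).
  by rewrite mulf_eq0 negb_or => /andP[cx _]; exact: supp.
have cw t : 0 < t -> {for t, continuous (exp_weight (alpha 0 i + 2^-1))}.
  exact: exp_weight_continuous.
have [Phi CPhi dPhi] := tensor_primitive i cw tF.
have main := primitive_flux_le oU U1 c0 h0 h2 cK KU FK F1 CPhi dPhi mF fi.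
(* The exact sign minus its substitute [2 * eta - 1] equals [2 * (1_P - eta)], and its product with
   [Delta] is nonnegative; this makes the identity exact. *)
have qE x : q x = W i x * F x * Delta x + 2 * (`|\1_P x - eta x| * q x).
  have /andP[e1 e2] := eta1 x; rewrite indicE.
  have [D0|D0] := leP 0 (Delta x).
    rewrite mem_set//= ger0_norm ?subr_ge0// /q /F (ger0_norm D0).
    by move: (chi x) (W i x) (Delta x) (eta x) => a b c z; ring.
  rewrite memNset /=; last by rewrite /P /= leNgt D0.
  rewrite sub0r normrN (ger0_norm e1) /q /F (ltr0_norm D0).
  by move: (chi x) (W i x) (Delta x) (eta x) => a b c z; ring.
have iB : lam.-integrable setT (fun x => (2 * (`|\1_P x - eta x| * q x))%:E).
  apply: (le_integrable measurableT _ _ (integrableZl measurableT 2 iq)).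
    apply/measurable_EFinP; apply: measurable_funM => //; apply: measurable_funM => //.
    by apply: measurableT_comp => //; apply: measurable_funB => //; exact: measurable_indic.
  move=> x _; rewrite -EFinM /= lee_fin !normrM normr_id ler_wpM2l// ler_piMl//.
  have /andP[e1 e2] := eta1 x.
  by rewrite indicE; case: (_ \in _) => /=; rewrite ler_norml; apply/andP; split; lra.
have iA : lam.-integrable setT (fun x => (W i x * F x * Delta x)%:E).
  apply: (le_integrable measurableT _ _ iq).
    by apply/measurable_EFinP; do 2 apply: measurable_funM => //.
  move=> x _; have /andP[e1 e2] := eta1 x.
  have h1 : `|2 * eta x - 1| <= 1 by rewrite ler_norml; apply/andP; split; lra.
  rewrite /= lee_fin (ger0_norm (q0 x)).
  rewrite (_ : W i x * F x * Delta x =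
      (chi x * W i x) * ((2 * eta x - 1) * Delta x)); last first.
    by rewrite /F; move: (chi x) (W i x) (Delta x) (eta x) => a b c z; ring.
  by rewrite normrM (ger0_norm (cW0 x)) /q ler_wpM2l// normrM ler_piMl.
rewrite (_ : (\int[lam]_x _)%E = (\int[lam]_x (W i x * F x * Delta x)%:E +
    \int[lam]_x (2 * (`|\1_P x - eta x| * q x))%:E)%E); last first.
  by rewrite -integralD//; apply: eq_integral => x _; rewrite -EFinD -qE.
apply: leeD; first exact: main.
under eq_integral do rewrite EFinM.
rewrite ge0_integralZl//; last 2 first.
- apply/measurable_EFinP; apply: measurable_funM => //.
  by apply: measurableT_comp => //; apply: measurable_funB => //; exact: measurable_indic.
- by move=> x _; rewrite lee_fin mulr_ge0.
rewrite (_ : e%:E = (2%:E * (e / 2)%:E)%E); last by rewrite -EFinM; congr EFin; field.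
by apply: lee_wpmul2l => //; rewrite lee_fin.
Qed.

(** Each direction contributes [4 ^+ d], from dominating test fields by cutoffs, times the weight
    comparison of [difference_quotient_le_variation]. *)
Lemma perimeter_integral_le_variation :
  (\int[@lebesgue_measure R]_t
     laguerre_perimeter alpha [set x | U x /\ (f x > t)%R] U <=
   (\sum_i 4 ^+ d * ratio_bound (alpha 0 i + 2^-1))%:E * laguerre_variation alpha U f)%E.
Proof.
pose h n := cutoff_step U n.
have hgt0 n : 0 < h n by exact: cutoff_step_gt0.
have h01 n : 0 < h n <= 1.
  rewrite hgt0/=; apply: le_trans (cutoff_step_le U n) _.
  by rewrite invf_le1 ?ltr0n// ler1n.
(* This is the weight in [flux_divergence_le] for [K = 4 ^+ d]; its factor [1 / h n] will cancel the
   [h n] gained from the variation estimate. *)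
pose q i n x := 4 ^+ d * (h n)^-1 * (cutoff U n x * W i x).
have cut1 n x : 0 <= cutoff U n x by case/andP: (cutoff_unit U n x).
have mcut n : measurable_fun setT (cutoff U n) by apply: measurable_tensor; exact: tensor_cutoff.
have q0 i n x : 0 <= q i n x.
  apply: mulr_ge0; first by rewrite mulr_ge0// ?exprn_ge0// invr_ge0 ltW.
  by apply: mulr_ge0 => //; exact: flux_weight_ge0.
have mq i n : measurable_fun setT (q i n).
  by apply: measurable_funM => //; apply: measurable_funM => //; exact: measurable_flux_weight.
pose G i n t := (\int[lam]_x (q i n x *
  `|above t (ft (x + h n *: delta_mx 0 i)) - above t (ft x)|)%:E)%E.
have G0 i n t : (0 <= G i n t)%E.
  by apply: integral_ge0 => x _; rewrite lee_fin mulr_ge0.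
have mG i n : measurable_fun setT (G i n : measurableTypeR R -> \bar R).
  exact: (tonelli_above lam (mq i n) (q0 i n) (mft_shift _) mft).1.
have GV i n : (\int[@lebesgue_measure R]_t G i n t <=
    (4 ^+ d * ratio_bound (alpha 0 i + 2^-1))%:E * laguerre_variation alpha U f)%E.
  rewrite (tonelli_above lam (mq i n) (q0 i n) (mft_shift (h n *: delta_mx 0 i)) mft).2.
  rewrite (_ : (\int[lam]_x _)%E = (\int[lam]_x ((4 ^+ d * (h n)^-1)%:E *
    (cutoff U n x * W i x * `|ft (x + h n *: delta_mx 0 i) - ft x|)%:E))%E); last first.
    by apply: eq_integral => x _; rewrite -EFinM /q !mulrA.
  rewrite ge0_integralZl//; last 3 first.
  - apply/measurable_EFinP; apply: measurable_funM.
      by apply: measurable_funM => //; exact: measurable_flux_weight.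
    by apply: measurableT_comp => //; apply: measurable_funB.
  - move=> x _; rewrite lee_fin; apply: mulr_ge0 => //.
    by apply: mulr_ge0 => //; exact: flux_weight_ge0.
  - by rewrite lee_fin mulr_ge0// ?exprn_ge0// invr_ge0 ltW.
  apply: (@le_trans _ _ ((4 ^+ d * (h n)^-1)%:E *
    ((ratio_bound (alpha 0 i + 2^-1) * h n)%:E * laguerre_variation alpha U f))%E).
    apply: lee_wpmul2l; first by rewrite lee_fin mulr_ge0// ?exprn_ge0// invr_ge0 ltW.
    exact: difference_quotient_le_variation.
  rewrite muleA -EFinM le_eqVlt; apply/orP; left; apply/eqP.
  by congr (_%:E * _)%E; field; rewrite gt_eqF.
have perG t : (laguerre_perimeter alpha [set x | U x /\ (f x > t)%R] U <=
    \sum_i limn_einf (G i ^~ t))%E.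
  apply: ge_ereal_sup => _ [phi phiU <-].
  rewrite (perimeter_integral alpha oU U1 phiU (measurable_superlevel oU t mf)
    (g := fun x => above t (ft x))); last by move=> x Ux; exact: indic_superlevel.
  apply: (@flux_divergence_le R d alpha U oU U1 phi phiU (fun x => above t (ft x))
    (cutoff U) h (4 ^+ d)) => //.
  - exact: measurable_above.
  - by move=> x; rewrite /above; case: (_ < _); rewrite ?normr1 ?normr0.
  - exact: cutoff_step_cvg0.
  - by move=> A cA AU; exact: cutoff_cover.
apply: (@le_trans _ _ (\int[@lebesgue_measure R]_t \sum_i limn_einf (G i ^~ t))%E).
  apply: le_integral_ge0r => // t; apply: sume_ge0 => i _.
  apply: (@cvg_le_limn_einf _ (cst 0%E)); first exact: cvg_cst.
  by apply: nearW => n; exact: G0.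
rewrite ge0_integral_sum//; last 2 first.
(* [limn_einf] unfolds to minus the [limn_esup] of the negated sequence, and measurability is taken
   from there. *)
- move=> i; rewrite /limn_einf; apply: measurableT_comp => //.
  apply: (measurable_fun_limn_esup (f := fun n t => (- G i n t)%E)) => n.
  by apply: measurableT_comp => //; exact: mG.
- move=> i t _; apply: (@cvg_le_limn_einf _ (cst 0%E)); first exact: cvg_cst.
  by apply: nearW => n; exact: G0.
rewrite -sumEFin ge0_sume_distrl; last first.
  by move=> i _; rewrite lee_fin mulr_ge0// ?exprn_ge0// ltW// ratio_bound_gt0.
apply: lee_sum => i _.
apply: (@le_trans _ _ (limn_einf (fun n => \int[@lebesgue_measure R]_t G i n t)%E)).
  by apply: fatou => // n; exact: mG.
by apply: limn_einf_le => n; exact: GV.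
Qed.

End fixed_function.
End coarea.

Section degenerate.
Context {R : realType} {d : nat} (alpha : 'rV[R]_d) (U : set 'rV[R]_d).
Hypothesis c0 : laguerre_const alpha = 0.

(* Allowing [Gamma (alpha_i + 1) = 0], where division makes the measure vanish,
   avoids proving that the Gamma integral is finite and positive. *)
Lemma laguerre_variation_degenerate f : laguerre_variation alpha U f = 0%E.
Proof.
have mu0 A : laguerre_measure alpha A = 0%E.
  by apply: integral0_eq => x [_ x0]; rewrite laguerre_densityE// c0 mul0r.
have I0 (g : 'rV[R]_d -> \bar R) : (\int[laguerre_measure alpha]_(x in U) g x = 0)%E.
  rewrite -[RHS](@integral_measure_zero _ 'rV[R]_d R U g).
  by apply: eq_measure_integral => A _ _; exact: mu0.
apply/eqP; rewrite eq_le; apply/andP; split.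
  by apply: ge_ereal_sup => _ [phi _ <-]; rewrite I0.
by apply: ereal_sup_ubound; exists (cst 0); [exact: test_fields0|exact: I0].
Qed.

End degenerate.

(** A point with a coordinate equal to 1 could be moved slightly inside the open set, making that
    coordinate smaller than 1. *)
Lemma open_unit_coords (R : realType) (d : nat) (U : set 'rV[R]_d) : open U ->
  (forall x, U x -> forall i, 1 <= x 0 i) -> forall x, U x -> forall i, 1 < x 0 i.
Proof.
move=> oU U1 x Ux i; have /nbhs_rVP[e e0 xe] : nbhs x U by exact: open_nbhs_nbhs.
have : U (x + (- (e / 2)) *: delta_mx 0 i).
  apply: xe => j; rewrite !mxE eqxx/= addrAC subrr add0r.
  by case: (j == i); rewrite ?mulr1 ?mulr0 ?normr0// normrN gtr0_norm; lra.
by move=> /U1 /(_ i); rewrite !mxE !eqxx mulr1; lra.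
Qed.

Theorem theorem2p11 (R : realType) (d : nat) (d_gt0 : (0 < d)%N)
    (alpha : 'rV[R]_d) (alpha_gtN1 : forall i, -1 < alpha 0 i)
    (Omega : set 'rV[R]_d) (Omega_pos : Omega `<=` pos_orthant)
    (Omega_open : open Omega) :
  let Omega1 := Omega `\`
    [set x | pos_orthant x /\ exists i, Num.sqrt (x 0 i) < 1] in
  open Omega1 ->
  exists c : R, 0 < c /\
    forall f : 'rV[R]_d -> R, laguerre_BV alpha Omega1 f ->
      let E (t : R) := [set x | Omega1 x /\ f x > t] in
      let I := (\int[@lebesgue_measure R]_t
                  laguerre_perimeter alpha (E t) Omega1)%E in
      (c^-1%:E * I <= laguerre_variation alpha Omega1 f)%E /\
      (laguerre_variation alpha Omega1 f <= c%:E * I)%E.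
Proof.
move=> U oU.
have U1 : forall x, U x -> forall i, 1 < x 0 i.
  apply: open_unit_coords => // x [Ox nx] i.
  rewrite leNgt; apply/negP => xi; apply: nx; split; first exact: Omega_pos.
  by exists i; rewrite -sqrtr1 ltr_sqrt.
have := laguerre_const_ge0 alpha; rewrite le_eqVlt => /orP[/eqP c0|c0].
  exists 1; split => // f _ E I.
  have I0 : I = 0%E by apply: integral0_eq => t _; exact: laguerre_variation_degenerate.
  by rewrite I0 !mule0 laguerre_variation_degenerate.
set C := \sum_i 4 ^+ d * ratio_bound (alpha 0 i + 2^-1).
have C0 : 0 <= C by apply: sumr_ge0 => i _; rewrite mulr_ge0 ?exprn_ge0// ltW// ratio_bound_gt0.
have C1 : 0 < 1 + C by rewrite ltr_wpDr.
(* [1 + C] serves both bounds: it is at least 1 for the upper one, at least [C] for the lower one,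
   and positive even if [C] were 0. *)
exists (1 + C); split => // f [fi Vf] E I.
have up : (laguerre_variation alpha U f <= I)%E by exact: variation_le_perimeter_integral.
have lo : (I <= C%:E * laguerre_variation alpha U f)%E by exact: perimeter_integral_le_variation.
have V0 := laguerre_variation_ge0 alpha U f.
have I0 : (0 <= I)%E by apply: le_trans up.
split; last first.
  apply: le_trans up _; rewrite -[leLHS]mul1e; apply: lee_wpmul2r => //.
  by rewrite lee_fin lerDl.
rewrite lee_pdivrMl//; apply: le_trans lo _; apply: lee_wpmul2r => //.
by rewrite lee_fin lerDr.
Qed.
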